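(* Let $d\ge 1$ be an integer. For every nonzero $f\in\mathrm{Sym}^d(\mathbb{R}^2)$, $$\max(\#\{\text{real roots of } f\},\,1)\ \le\ \#\{\text{real eigenvectors of } f\}.$$ Moreover, this is the only constraint on the number of real roots, in the following sense: for any pair $(q,t)$ of nonnegative integers such that $q\equiv t\equiv d \pmod 2$ and $\max(q,1)\le t\le d$, the set $$\{f\in\mathrm{Sym}^d(\mathbb{R}^2)\ :\ \#\{\text{real roots of } f\}=q,\ \#\{\text{real eigenvectors of } f\}=t\}$$ has positive volume.
   Context: $\mathrm{Sym}^d(\mathbb{R}^2)$ denotes the real vector space of homogeneous polynomials of degree $d$ in two variables $x,y$ with real coefficients (binary forms of degree $d$); it is identified with $\mathbb{R}^{d+1}$ via coefficients, and volume means Lebesgue measure. A real eigenvector of $f$ is a nonzero vector $v\in\mathbb{R}^2$ such that $\nabla f(v)=\lambda v$ for some $\lambda\in\mathbb{R}$ ($\lambda=0$ is allowed); equivalently, $v$ is a nonzero real zero of $y f_x - x f_y$. Eigenvectors are counted up to nonzero real scalar multiples, i.e. as points of $\mathbb{P}^1(\mathbb{R})$ (their number may be infinite). The real roots of $f$ are the points of $\mathbb{P}^1(\mathbb{R})$ at which $f$ vanishes. *)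

(* Defs.v *)
From HB Require Import structures.
From mathcomp Require Import all_boot all_order all_algebra.
From mathcomp Require Import all_classical all_reals all_analysis.
(* The notations of mpoly clash with those of MathComp-Analysis. *)
From mathcomp Require Import -(notations) mpoly.

Set Implicit Arguments.
Unset Strict Implicit.
Unset Printing Implicit Defensive.

Import Order.TTheory GRing.Theory Num.Theory.

Local Open Scope classical_set_scope.
Local Open Scope ring_scope.

(* Polynomials in x = 'X_0 and y = 'X_1. *)
Definition bpoly (R : realType) := mpoly 2 R.

Definition binary_form (R : realType) (d : nat) : set (bpoly R) :=
  [set f : bpoly R | f \is ishomog1 d mdeg].

Definition bevaluate (R : realType) (f : bpoly R) (v : 'rV[R]_2) : R :=
  meval (fun i => v ord0 i) f.

Definition gradient (R : realType) (f : bpoly R) (v : 'rV[R]_2) : 'rV[R]_2 :=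
  \row_(i < 2) bevaluate (mderiv i f) v.

Definition is_real_eigenvector (R : realType) (f : bpoly R) (v : 'rV[R]_2) :
    Prop :=
  v != 0 /\ exists lambda : R, gradient f v = lambda *: v.

(* A point of P^1(R) is represented by the line <[v]> spanned by a nonzero
   vector v of R^2, so each set below counts vectors up to nonzero scalars. *)
Definition real_roots (R : realType) (f : bpoly R) : set {vspace 'rV[R]_2} :=
  [set <[v]>%VS | v in [set v | v != 0 /\ bevaluate f v = 0]].

Definition real_eigenvectors (R : realType) (f : bpoly R) :
    set {vspace 'rV[R]_2} :=
  [set <[v]>%VS | v in [set v | is_real_eigenvector f v]].

(* The i-th coordinate is the coefficient of x^i y^(d-i). *)
Definition form_coords (R : realType) (d : nat) (f : bpoly R) :
    d.+1.-tuple R :=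
  [tuple mcoeff (Multinom [tuple (i : nat); (d - i)%N]) f
     | i < d.+1].

(* Lebesgue measure on the Borel subsets of R^n, as an n-fold product. *)
Fixpoint lebesgue_tuple (R : realType) (n : nat) : set (n.-tuple R) -> \bar R :=
  match n return set (n.-tuple R) -> \bar R with
  | 0 => \d_ ([tuple] : 0.-tuple R)
  | m.+1 => pushforward (@lebesgue_measure R \x @lebesgue_tuple R m)%E
      (fun z : R * m.-tuple R => [tuple of z.1 :: z.2])
  end.

Definition positive_volume (R : realType) (d : nat) (S : set (bpoly R)) :
    Prop :=
  measurable (form_coords d @` S) /\
  (0 < lebesgue_tuple (form_coords d @` S))%E.

(* Main.v *)
Require Import Defs.
From mathcomp Require Import all_boot all_order all_algebra.
From mathcomp Require Import all_classical all_reals all_analysis.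
From mathcomp Require Import -(notations) mpoly.
From mathcomp Require Import measurable_realfun ring lra.

(** Restrict a binary form [f] of degree [d] to the unit circle, that is, look at
    [g x = f (cos x, sin x)].  Then [g (x + pi) = (-1) ^+ d * g x], so the zeros
    of [g] live on the circle of angles modulo [pi], which is the real
    projective line.  The derivative [g'] is the restriction of the form
    [x f_y - y f_x], written [dcirc f] below, and this form vanishes at [v] exactly
    when [gradient f v] is parallel to [v].  Hence real roots are zeros of [g]
    modulo [pi] and real eigenvectors are zeros of [g'] modulo [pi]
    ([real_roots_zero_lines], [eigenvectors_dcirc]).

    The inequality is Rolle's theorem on this circle: between two consecutive
    zeros lies a critical point ([critical_lines_injection]), and a critical
    point exists even if there is no zero ([critical_line_exists]).

    For the second part one has to show that a set of coefficient vectors is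
    Borel and that it contains an open box.

    It is Borel because having at least [k] zeros is a countable
    combination of conditions that bound the value of [g] at one angle, and
    such a value is linear in the coefficients ([measurable_counting_ge]).

    The open box surrounds an explicit form.  Put [K = (t - q) / 2] and
    take [q + K] distinct lines, with linear factors [l_i].  Let [P] be the product
    of [q] of the [l_i] and [Q] the product of the others.  On the circle
    [P * Q ^+ 2] is log-concave between its zeros, being a product of sines, so its
    critical points are exactly one nondegenerate maximum of the absolute value
    in each of the [q + K] gaps, and the [K] double zeros, which are
    nondegenerate too: [q + 2 * K = t] in total ([exists_critical_family]).  The
    form [P * (Q ^+ 2 + eps * (x ^+ 2 + y ^+ 2) ^+ K)] then has exactly the [q]
    simple zeros of [P], and keeps [t] critical points if [eps > 0] is small.
    Multiplying by a power of [x ^+ 2 + y ^+ 2] reaches degree [d] without changing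
    [g].  Finally, the number of zeros of a function whose zeros are all simple does
    not change under small perturbations ([stable_zero_lines]); applied to
    [g] and to [g'], this produces the box ([exists_open_box]), and a set that
    contains a box has positive volume ([lebesgue_tuple_box]). *)

Set Implicit Arguments.
Unset Strict Implicit.
Unset Printing Implicit Defensive.

Import Order.TTheory GRing.Theory Num.Theory.
Import numFieldNormedType.Exports.

Local Open Scope classical_set_scope.
Local Open Scope ring_scope.

(** * Counting a set by injections from ordinals *)

Section Counting.
Context {R : realType}.

Lemma counting_geP (T : choiceType) (A : set T) n :
  (n%:R%:E <= counting A :> \bar R)%E <->
  exists w : 'I_n -> T, injective w /\ forall i, A (w i).
Proof.
have inF (s : seq T) : (n <= size s)%N -> uniq s -> (forall x, x \in s -> A x) ->
    exists w : 'I_n -> T, injective w /\ forall i, A (w i).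
  move=> ns us sA; exists (fun i => tnth (in_tuple s) (widen_ord ns i)); split.
    by move=> i j /(tuple_uniqP (in_tuple s) us) [ij]; exact: val_inj.
  by move=> i; apply: sA; exact: mem_tnth.
rewrite /counting; case: asboolP => [fA|iA]; split.
- rewrite lee_fin ler_nat => nA; apply: (inF _ nA) => //.
  by move=> x; rewrite in_fset_set// inE.
- move=> [w [winj wA]]; rewrite lee_fin ler_nat.
  have <- : size (codom w) = n by rewrite size_codom card_ord.
  apply: uniq_leq_size; first exact/injectiveP.
  by move=> _ /codomP[i ->]; rewrite in_fset_set// inE.
- move=> _; have [B BA nB] := infinite_set_fset n iA.
  by apply: (inF (finmap.enum_fset B)) => // x xB; exact: BA.
- by rewrite leey.
Qed.

(** Comparing injections from all ordinals treats finite and infinite sets alike: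
    an infinite [A] forces arbitrarily large injections into [B]. *)
Lemma counting_le (T T' : choiceType) (A : set T) (B : set T') :
  (forall n (w : 'I_n -> T), injective w -> (forall i, A (w i)) ->
    exists w' : 'I_n -> T', injective w' /\ forall i, B (w' i)) ->
  (counting A <= counting B :> \bar R)%E.
Proof.
move=> AB.
have AB' n : (n%:R%:E <= counting A :> \bar R)%E ->
             (n%:R%:E <= counting B :> \bar R)%E.
  by move=> /counting_geP[w [wi wA]]; apply/counting_geP; exact: AB wi wA.
rewrite {1}/counting; case: asboolP => [fA|iA].
  by apply: AB'; rewrite /counting asboolT.
have {iA} cA : counting A = +oo%E :> \bar R by rewrite /counting asboolF.
rewrite {1}/counting; case: asboolP => [fB|//].
set m := size _; have := AB' m.+1; rewrite cA leey => /(_ isT).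
by rewrite /counting asboolT// -/m lee_fin ler_nat ltnn.
Qed.

Lemma counting_eqP (T : choiceType) (A : set T) n :
  (counting A = n%:R%:E :> \bar R) <->
  ((n%:R%:E <= counting A :> \bar R)%E /\
   ~ (n.+1%:R%:E <= counting A :> \bar R)%E).
Proof.
split=> [->|]; first by rewrite !lee_fin !ler_nat ltnn leqnn.
rewrite /counting; case: asboolP => [fA|iA]; last by move=> [_ /(_ (leey _))].
rewrite !lee_fin !ler_nat => -[h1 /negP h2]; congr (_%:R%:E).
by apply/eqP; rewrite eqn_leq h1 andbT leqNgt.
Qed.

Lemma counting_range (T : choiceType) (I : finType) (w : I -> T) :
  injective w -> counting (range w) = #|I|%:R%:E :> \bar R.
Proof.
move=> winj; apply/counting_eqP; split.
  apply/counting_geP; exists (w \o enum_val); split=> [|i /=]; last by exists (enum_val i).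
  exact: inj_comp winj enum_val_inj.
move=> /counting_geP[v [vinj vw]].
have /choice[g gv] : forall i, exists j, w j = v i.
  by move=> i; have [j _ <-] := vw i; exists j.
have ginj : injective g by move=> i j gij; apply: vinj; rewrite -!gv gij.
by have := leq_card g ginj; rewrite card_ord ltnn.
Qed.

End Counting.

(** * Zeros and critical points of real functions *)

Section Calculus.
Context {R : realType}.
Implicit Types (h dh : R -> R).

Lemma derive_continuous h dh :
  (forall x : R, is_derive x 1 h (dh x)) -> continuous h.
Proof.
move=> hd x; apply: differentiable_continuous; apply/derivable1_diffP.
by have := hd x; case.
Qed.

Lemma critical_between h dh a b : (forall x : R, is_derive x 1 h (dh x)) ->
  a < b -> h a = h b -> exists2 c, a < c < b & dh c = 0.
Proof.
move=> hd ab hab; have hc := derive_continuous hd.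
have [||c cab hc0] := Rolle ab _ _ hab.
- by move=> x _; have := hd x; case.
- exact: continuous_subspaceT.
exists c; first by rewrite in_itv in cab.
by have [_ <-] := hd c; case: hc0.
Qed.

Lemma zero_between h a b : continuous h -> a <= b -> h a * h b < 0 ->
  exists2 c, a <= c <= b & h c = 0.
Proof.
move=> hc ab hab; have [||c cab c0] := @IVT R h a b 0 ab.
- exact: continuous_subspaceT.
- rewrite ge_min le_max; case: (ltgtP (h a) 0) => ha /=; case: (ltgtP (h b) 0) => hb //=.
    by have := mulr_le0 (ltW ha) (ltW hb); rewrite leNgt hab.
  by have := mulr_gt0 ha hb; rewrite ltNge (ltW hab).
by exists c => //; rewrite in_itv in cab.
Qed.

Lemma segment_bounded h a b : continuous h ->
  exists2 M, 0 < M & forall x, a <= x <= b -> `|h x| <= M.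
Proof.
move=> hc; have [ab|ba] := leP a b; last first.
  by exists 1 => // x /andP[ax xb]; have := le_trans ax xb; rewrite leNgt ba.
have [|c _ hM] := @EVT_max R (fun x => `|h x|) a b ab.
  by apply: continuous_subspaceT => x; apply: cvg_norm; exact: hc.
exists (`|h c| + 1); first by rewrite ltr_wpDl.
by move=> x xab; rewrite (le_trans (hM x _)) ?in_itv//= lerDl.
Qed.

Lemma segment_nonzero h a b : continuous h ->
  (forall x, a <= x <= b -> h x != 0) ->
  exists2 m, 0 < m & forall x, a <= x <= b -> m <= `|h x|.
Proof.
move=> hc h0; have [ab|ba] := leP a b; last first.
  by exists 1 => // x /andP[ax xb]; have := le_trans ax xb; rewrite leNgt ba.
have [|c cab hM] := @EVT_min R (fun x => `|h x|) a b ab.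
  by apply: continuous_subspaceT => x; apply: cvg_norm; exact: hc.
exists (`|h c|); first by rewrite normr_gt0 h0//; rewrite in_itv in cab.
by move=> x xab; rewrite hM ?in_itv.
Qed.

End Calculus.

(** * Lines of the plane as angles modulo pi *)

Section Lines.
Context {R : realType}.

Definition direction (x : R) : 'rV[R]_2 :=
  \row_i (if i == ord0 then cos x else sin x).

Definition line (x : R) : {vspace 'rV[R]_2} := <[direction x]>%VS.

Lemma direction0 x : direction x ord0 ord0 = cos x.
Proof. by rewrite mxE. Qed.

Lemma direction1 x : direction x ord0 ord_max = sin x.
Proof. by rewrite mxE. Qed.

Lemma row2P (u v : 'rV[R]_2) :
  u ord0 ord0 = v ord0 ord0 -> u ord0 ord_max = v ord0 ord_max -> u = v.
Proof.
move=> uv0 uv1; apply/rowP => i.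
case: i => [[|[|//]] Hi].
  by rewrite (_ : Ordinal Hi = ord0)//; exact: val_inj.
by rewrite (_ : Ordinal Hi = ord_max)//; exact: val_inj.
Qed.

Lemma direction_neq0 x : direction x != 0.
Proof.
apply/eqP => /rowP x0; have := cos2Dsin2 x.
rewrite -(direction0 x) -(direction1 x) !x0 !mxE expr0n addr0 => /eqP.
by rewrite eq_sym oner_eq0.
Qed.

Lemma line_eqP x y : line x = line y <-> sin (x - y) = 0.
Proof.
have sub a b : sin (a - b) = 0 -> (line a <= line b)%VS.
  move=> ab; rewrite -memvE; apply/vlineP; exists (cos (a - b)).
  apply: row2P; rewrite [RHS]mxE ?direction0 ?direction1.
    by rewrite -[in LHS](subrK b a) cosD ab mul0r subr0.
  by rewrite -[in LHS](subrK b a) sinD ab mul0r add0r.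
split=> [xy|xy]; last first.
  apply/eqP; rewrite eqEsubv !sub//.
  by rewrite -opprB sinN xy oppr0.
have : direction x \in line y by rewrite -xy memv_line.
move=> /vlineP[k xk].
have cx : cos x = k * cos y by rewrite -!direction0 xk mxE.
have sx : sin x = k * sin y by rewrite -!direction1 xk mxE.
by rewrite sinB cx sx; ring.
Qed.

Lemma line_addpi x : line (x + pi) = line x.
Proof. by apply/line_eqP; rewrite addrAC subrr add0r sinpi. Qed.

(** The bound [pi], rather than a fixed fundamental domain, lets two angles be
    compared inside any half-open window of length [pi]. *)
Lemma line_inj x y : `|x - y| < pi -> line x = line y -> x = y.
Proof.
move=> xy /line_eqP s0; apply/eqP; rewrite -subr_eq0; apply/negPn/negP => xy0.
wlog xgt : x y xy s0 xy0 / 0 < x - y.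
  move=> H; have [|xley] := ltP 0 (x - y); first exact: H xy s0 xy0.
  apply: (H y x); first by rewrite distrC.
  - by rewrite -opprB sinN s0 oppr0.
  - by rewrite -opprB oppr_eq0.
  - by rewrite -opprB oppr_gt0 lt_neqAle xy0.
have xpi : 0 < x - y < pi by rewrite xgt (le_lt_trans (ler_norm _) xy).
by have := sin_gt0_pi xpi; rewrite s0 ltxx.
Qed.

Lemma line_inj_half_open x y : 0 <= x < pi -> 0 <= y < pi ->
  line x = line y -> x = y.
Proof. by move=> xP yP; apply: line_inj; rewrite ltr_norml; lra. Qed.

Lemma line_surj (v : 'rV[R]_2) : v != 0 ->
  exists x r, [/\ 0 <= x < pi, r != 0 & v = r *: direction x].
Proof.
move=> v0; pose a := v ord0 ord0; pose b := v ord0 ord_max.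
have ab0 : 0 < a ^+ 2 + b ^+ 2.
  rewrite lt_neqAle addr_ge0 ?sqr_ge0// andbT eq_sym paddr_eq0 ?sqr_ge0//.
  rewrite !sqrf_eq0; apply: contra v0 => /andP[/eqP a0 /eqP b0].
  by apply/eqP/row2P; rewrite mxE.
pose n := Num.sqrt (a ^+ 2 + b ^+ 2).
have n0 : 0 < n by rewrite sqrtr_gt0.
have n2 : n ^+ 2 = a ^+ 2 + b ^+ 2 by rewrite sqr_sqrtr// ltW.
have key c s : c ^+ 2 + s ^+ 2 = 1 -> 0 <= s ->
    exists2 x : R, 0 <= x <= pi & c = cos x /\ s = sin x.
  move=> cs s0; have c1 : -1 <= c <= 1 by nra.
  exists (acos c); first by rewrite acos_ge0// acos_lepi.
  rewrite acosK ?in_itv//; split=> //; rewrite sin_acos//.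
  by rewrite -cs addrAC subrr add0r sqrtr_sqr ger0_norm.
(* The angle given by acos lies in the upper half-plane, so [v] is first moved
   there by a sign [e]; the ray of angle [pi] is then brought back to [0]. *)
have [e [e0 e2 sb]] : exists e : R, [/\ e != 0, e ^+ 2 = 1 & 0 <= e * b].
  have [b0|b0] := leP 0 b; first by exists 1; rewrite oner_neq0 expr1n mul1r.
  by exists (-1); rewrite oppr_eq0 oner_neq0 sqrrN expr1n mulN1r oppr_ge0 ltW.
have [||x x0pi [cx sx]] := key (e * a / n) (e * b / n).
- by rewrite !expr_div_n !exprMn e2 !mul1r -mulrDl -n2 divff// expf_neq0// gt_eqF.
- by rewrite mulr_ge0// invr_ge0 ltW.
have vE r y : cos y = r * a / n -> sin y = r * b / n -> r * r = 1 ->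
    v = (r * n) *: direction y.
  move=> cy sy rr; have nn : n != 0 by rewrite gt_eqF.
  apply: row2P; rewrite [RHS]mxE ?direction0 ?direction1 ?cy ?sy -/a -/b.
    by rewrite -[LHS]mul1r -rr; field.
  by rewrite -[LHS]mul1r -rr; field.
have [xpi|] := ltP x pi.
  exists x, (e * n); split; [by case/andP: x0pi => ->|by rewrite mulf_neq0// gt_eqF|].
  by apply: vE => //; rewrite -expr2.
move=> pix; have xpi : x = pi by apply/eqP; rewrite eq_le pix; case/andP: x0pi => _ ->.
exists 0, (- e * n); split; first by rewrite lexx pi_gt0.
  by rewrite mulNr oppr_eq0 mulf_neq0// gt_eqF.
apply: vE; last by rewrite mulrNN -expr2.
  by rewrite cos0 !mulNr cx xpi cospi opprK.
by rewrite sin0 !mulNr sx xpi sinpi oppr0.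
Qed.

End Lines.

(** * Rolle's theorem modulo pi *)

Section ZeroLines.
Context {R : realType}.
Implicit Types (h dh : R -> R).

Definition zero_lines h : set {vspace 'rV[R]_2} :=
  line @` [set x | 0 <= x < pi /\ h x = 0].

(** The behaviour on the circle of a form of degree [d], since [x + pi] is the
    direction opposite to [x]. *)
Definition pi_equivariant d h := forall x : R, h (x + pi) = (-1) ^+ d * h x.

Lemma pi_equivariant_eq0 d h x : pi_equivariant d h ->
  (h (x + pi) == 0) = (h x == 0).
Proof. by move=> hd; rewrite hd mulf_eq0 signr_eq0. Qed.

Lemma mem_zero_lines d h x : pi_equivariant d h -> - pi <= x < pi *+ 2 ->
  h x = 0 -> zero_lines h (line x).
Proof.
move=> hd xP hx; have [x0|x0] := ltP x 0.
  exists (x + pi); last exact: line_addpi.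
  split; first lra.
  by apply/eqP; rewrite (pi_equivariant_eq0 _ hd) hx.
have [xpi|xpi] := ltP x pi; first by exists x => //; split=> //; rewrite x0.
exists (x - pi); last by rewrite -[in RHS](subrK pi x) line_addpi.
split; first lra.
by apply/eqP; rewrite -(pi_equivariant_eq0 _ hd) subrK hx.
Qed.

(** Rolle's theorem needs two equal values at distance [pi].  If [d] is even any
    angle will do; if [d] is odd, [h] changes sign over a half turn, hence has a
    zero [c], and then [c + pi] is a zero as well. *)
Lemma critical_line_exists d h dh : (forall x : R, is_derive x 1 h (dh x)) ->
  pi_equivariant d h -> pi_equivariant d dh -> zero_lines dh !=set0.
Proof.
move=> hD hd dhd; have pi0 := pi_gt0 R.
have [c cpi hc] : exists2 c, 0 <= c <= pi & h c = h (c + pi).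
  have [|d0] := boolP (odd d) => [d1|].
    have hN x : h (x + pi) = - h x by rewrite hd -signr_odd d1 mulN1r.
    have [h0|h0] := eqVneq (h 0) 0.
      by exists 0; rewrite ?lexx ?pi_ge0// hN h0 oppr0.
    have [|c c0 hc] := zero_between (derive_continuous hD) (ltW pi0).
      rewrite -[pi]add0r hN mulrN oppr_lt0 -expr2 lt_neqAle sqr_ge0 andbT eq_sym.
      by rewrite sqrf_eq0.
    by exists c => //; rewrite hN hc oppr0.
  by exists 0; rewrite ?lexx ?pi_ge0// hd -signr_odd (negbTE d0) mul1r.
have [|x xP x0] := critical_between hD _ hc; first by rewrite ltrDl.
by exists (line x); apply: mem_zero_lines dhd _ x0; lra.
Qed.

Lemma zero_lines_reps n h (w : 'I_n -> {vspace 'rV[R]_2}) :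
  injective w -> (forall i, zero_lines h (w i)) ->
  exists t : seq R, [/\ size t = n, sorted <%R t &
    forall x, x \in t -> 0 <= x < pi /\ h x = 0].
Proof.
move=> wi w0.
have /choice[x xw] : forall i, exists x, (0 <= x < pi /\ h x = 0) /\ line x = w i.
  by move=> i; have [x xP xw] := w0 i; exists x.
have xi : injective x.
  by move=> i j xij; apply: wi; case: (xw i) (xw j) => _ <- [_ <-]; rewrite xij.
exists (sort <=%R (codom x)); split.
- by rewrite size_sort size_codom card_ord.
- by rewrite sort_lt_sorted; exact/injectiveP.
- by move=> y; rewrite mem_sort => /codomP[i ->]; case: (xw i).
Qed.

(** Sort representatives of [n] zeros in [0, pi) and close the list up with the
    first one plus [pi].  The [n] gaps each contain a critical point, and these lie
    in one open window of length [pi], so that they span distinct lines. *)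
Lemma critical_lines_injection d h dh n (w : 'I_n -> {vspace 'rV[R]_2}) :
  (forall x : R, is_derive x 1 h (dh x)) ->
  pi_equivariant d h -> pi_equivariant d dh ->
  injective w -> (forall i, zero_lines h (w i)) ->
  exists w' : 'I_n -> {vspace 'rV[R]_2},
    injective w' /\ forall i, zero_lines dh (w' i).
Proof.
move=> hD hd dhd wi w0; have pi0 := pi_gt0 R.
have [t [tn ts tz]] := zero_lines_reps wi w0.
pose a i := if (i < n)%N then nth 0 t i else nth 0 t 0 + pi.
have tnth i : (i < n)%N -> 0 <= nth 0 t i < pi /\ h (nth 0 t i) = 0.
  by move=> it; apply: tz; rewrite mem_nth// tn.
have az i : (0 < n)%N -> h (a i) = 0.
  move=> n0; rewrite /a; case: ifP => [/tnth[]//|_].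
  by rewrite hd (tnth _ n0).2 mulr0.
have alt i j : (i < j <= n)%N -> a i < a j.
  move=> /andP[ij jn]; rewrite /a (leq_trans ij jn); case: ltnP => jn'.
    by rewrite lt_sorted_ltn_nth// inE tn// (ltn_trans ij).
  have [it _] := tnth _ (leq_trans ij jn).
  have [t0 _] := tnth _ (leq_ltn_trans (leq0n i) (leq_trans ij jn)).
  by lra.
have ale i j : (i <= j <= n)%N -> a i <= a j.
  by case/andP; rewrite leq_eqVlt => /predU1P[->//|ij jn]; rewrite ltW// alt// ij.
have /choice[c cP] : forall i : 'I_n, exists c, a i < c < a i.+1 /\ dh c = 0.
  move=> i; have n0 : (0 < n)%N by exact: leq_ltn_trans (ltn_ord i).
  have ai : a i < a i.+1 by apply: alt; rewrite ltnSn ltn_ord.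
  have hai : h (a i) = h (a i.+1) by rewrite !az.
  by have [c aci dc0] := critical_between hD ai hai; exists c.
have c0 i : a 0 < c i < a 0 + pi.
  have n0 : (0 < n)%N by exact: leq_ltn_trans (ltn_ord i).
  have [/andP[c1 c2] _] := cP i; rewrite (le_lt_trans (ale 0%N i _) c1)/=; last first.
    by rewrite ltnW.
  rewrite (lt_le_trans c2)// (le_trans (ale i.+1 n _))//; first by rewrite leqnn andbT.
  by rewrite /a n0 ltnn.
exists (line \o c); split=> [i j /= cij|i /=]; last first.
  have n0 : (0 < n)%N by exact: leq_ltn_trans (ltn_ord i).
  apply: mem_zero_lines dhd _ (cP i).2; have := c0 i.
  by rewrite /a n0; have [] := tnth _ n0; lra.
have {}cij : c i = c j.
  by apply: line_inj cij; have := c0 i; have := c0 j; rewrite ltr_norml; lra.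
have neq (k l : 'I_n) : (k < l)%N -> c k < c l.
  move=> kl; have [/andP[_ c1] _] := cP k; have [/andP[c2 _] _] := cP l.
  by rewrite (lt_le_trans c1)// (le_trans _ (ltW c2))// ale// kl ltnW.
by apply/val_inj; case: (ltngtP i j) => // /neq; rewrite cij ltxx.
Qed.

End ZeroLines.

(** * Stability of simple zeros *)

Section Stability.
Context {R : realType}.
Implicit Types (h dh k dk : R -> R).

Lemma finite_common_radius (I : finType) (P : I -> R -> Prop) :
  (forall i, exists2 e, 0 < e & forall e', 0 < e' <= e -> P i e') ->
  exists2 e, 0 < e & forall i e', 0 < e' <= e -> P i e'.
Proof.
move=> H; have /choice[f fP] : forall i, exists e, 0 < e /\ forall e', 0 < e' <= e -> P i e'.
  by move=> i; have [e e0 eP] := H i; exists e.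
exists (\big[Num.min/1]_i f i).
  by apply: lt_bigmin => // i _; case: (fP i).
move=> i e' /andP[e'0 e'f]; apply: (fP i).2; rewrite e'0 (le_trans e'f)//.
exact: bigmin_le_cond.
Qed.

Lemma opposite_signs h dh x r : (forall x : R, is_derive x 1 h (dh x)) ->
  continuous dh -> 0 < r -> h x = 0 ->
  (forall y, `|y - x| <= r -> dh y != 0) -> h (x - r) * h (x + r) < 0.
Proof.
move=> hD dhc r0 hx dh0; have hc := derive_continuous hD.
have [||c1 c1P h1] := @MVT R h dh (x - r) x; first by lra.
  exact: continuous_subspaceT.
have [||c2 c2P h2] := @MVT R h dh x (x + r); first by lra.
  exact: continuous_subspaceT.
rewrite !in_itv/= in c1P c2P.
(* The derivative keeps its sign on the arc, as otherwise it would vanish. *)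
have dc : 0 < dh c1 * dh c2.
  rewrite lt_neqAle eq_sym mulf_neq0 ?dh0 ?ler_norml/=; try lra.
  rewrite leNgt; apply/negP => dc; have [|c cP c0] := zero_between dhc _ dc; first by lra.
  by have /eqP[] : dh c != 0 by apply: dh0; rewrite ler_norml; lra.
rewrite hx sub0r subKr in h1; rewrite hx subr0 addrAC subrr add0r in h2.
rewrite h2 -[h (x - r)]opprK h1 mulNr oppr_lt0 mulrACA pmulr_rgt0//.
by rewrite mulr_gt0.
Qed.

Lemma same_sign (a a' m : R) : m <= `|a| -> `|a' - a| < m -> 0 < a * a'.
Proof.
rewrite ltr_norml; case: (ltgtP a 0) => [a0|a0|->].
- by rewrite ltr0_norm// => ma aa; rewrite nmulr_rgt0//; lra.
- by rewrite gtr0_norm// => ma aa; rewrite pmulr_rgt0//; lra.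
- by rewrite normr0; lra.
Qed.

Section Perturbation.
Variables (d : nat) (h dh : R -> R) (I : finType) (w : I -> R).
Hypothesis hD : forall x : R, is_derive x 1 h (dh x).
Hypothesis dhc : continuous dh.
Hypothesis hd : pi_equivariant d h.
Hypothesis dhd : pi_equivariant d dh.
Hypothesis wI : injective w.
Hypothesis w_pi : forall i, 0 <= w i < pi.
Hypothesis h_w : forall i, h (w i) = 0.
Hypothesis dh_w : forall i, dh (w i) != 0.
Hypothesis h_eq0 : forall x, 0 <= x < pi -> h x = 0 -> exists i, x = w i.

(** An arc around a zero close to [0] or [pi] may leave [[0, pi]], and translations
    by [-pi], [0] and [pi] suffice to bring it back. *)
Let shift (k : 'I_3) : R := (k%:R - 1) * pi.

Let pi_hom_shift u (k : 'I_3) x : pi_equivariant d u ->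
  (u (x + shift k) == 0) = (u x == 0).
Proof.
rewrite /shift => ud; case: k => [[|[|[|//]]] Hk] /=.
- by rewrite -(pi_equivariant_eq0 _ ud) sub0r mulN1r subrK.
- by rewrite subrr mul0r addr0.
- by rewrite -[2]/(1 + 1) addrK mul1r (pi_equivariant_eq0 _ ud).
Qed.

Let line_shift (k : 'I_3) x : line (x + shift k) = line x.
Proof.
rewrite /shift; case: k => [[|[|[|//]]] Hk] /=.
- by rewrite -line_addpi sub0r mulN1r subrK.
- by rewrite subrr mul0r addr0.
- by rewrite -[2]/(1 + 1) addrK mul1r line_addpi.
Qed.

Let simple_radius : exists r, 0 < r <= 1 /\
  forall i x, `|x - w i| <= r -> dh x != 0.
Proof.
have [|r r0 rP] := @finite_common_radius I (fun i r => forall x, `|x - w i| <= r -> dh x != 0).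
  move=> i; have : \forall x \near w i, dh x != 0.
    by apply: (@cvgr_neq0 R R R (nbhs (w i)) _ dh (dh (w i))); [exact: dhc|].
  move=> /nbhs_ballP[e /= e0 eP]; exists (e / 2); first lra.
  move=> e' e'e x xw; apply: eP; rewrite /ball /= distrC.
  by lra.
exists (Num.min r 1); rewrite lt_min r0 ltr01 ge_min lexx orbT; split=> // i.
by apply: rP; rewrite lt_min r0 ltr01 ge_min lexx.
Qed.

Let nonzero_far (r : R) : 0 < r -> exists2 m, 0 < m &
  forall x : R, 0 <= x < pi -> (forall i (j : 'I_3), r <= `|x + shift j - w i|) -> m <= `|h x|.
Proof.
move=> r0; have hc := derive_continuous hD.
pose C : set R := `[0, pi] `&` \bigcap_(p in [set: I * 'I_3])
  [set x | r <= `|x + shift p.2 - w p.1|].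
have Ccompact : compact C.
  apply: (@subclosed_compact _ _ `[0, pi]); [|exact: segment_compact|by move=> x []].
  apply: closedI; first exact: itv_closed.
  apply: closed_bigI => -[i k] _ /=.
  apply: (@closed_comp _ _ (fun x => `|x + shift k - w i|) [set y | r <= y]).
    move=> x _; apply: cvg_norm; apply: cvgB; last exact: cvg_cst.
    by apply: cvgD; [exact: cvg_id|exact: cvg_cst].
  exact: closed_ge.
have CP x : 0 <= x < pi -> (forall i (j : 'I_3), r <= `|x + shift j - w i|) -> C x.
  by move=> /andP[x0 xpi] xr; split; [rewrite /= in_itv/= x0 ltW|move=> [i k] _; exact: xr].
have [C0|/set0P/negP/negPn/eqP C0] := pselect (C !=set0); last first.
  by exists 1 => // x x0 xr; have := CP x x0 xr; rewrite C0.
have [|c cC cmin] := @compact_EVT_min R R (fun x => `|h x|) C C0 Ccompact.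
  by apply: continuous_subspaceT => x; apply: cvg_norm; exact: hc.
rewrite inE in cC.
exists `|h c|; last by move=> x x0 xr; apply: cmin; rewrite inE; exact: CP.
rewrite normr_gt0; apply/eqP => hc0.
have [x [k [x0 xk hx]]] : exists x (k : 'I_3), [/\ 0 <= x < pi, x = c + shift k & h x = 0].
  have [/= + _] := cC; rewrite in_itv/= => /andP[c0 cpi].
  have [cltpi|pic] := ltP c pi.
    by exists c, (@Ordinal 3 1 isT); rewrite /shift/= subrr mul0r addr0 c0.
  exists 0, (@Ordinal 3 0 isT); rewrite /shift/= sub0r mulN1r lexx pi_gt0.
  have cE : c = pi by apply/eqP; rewrite eq_le cpi.
  rewrite cE subrr; split=> //; apply/eqP.
  by rewrite -(pi_equivariant_eq0 _ hd) add0r -cE hc0.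
have [i xw] := h_eq0 x0 hx; have /(_ (i, k) Logic.I) := cC.2.
by rewrite /= -xk xw subrr normr0 leNgt r0.
Qed.

(** Around each zero [w i], choose an arc of radius [r] on which [dh] has no zero.
    A close enough [k] still changes sign across every arc and still has
    nonzero derivative there, hence has exactly one zero in each arc; away from
    the arcs it cannot vanish, as [h] is bounded below on that compact set.  The
    zeros of [k] in different arcs span different lines: if two arcs met
    modulo [pi], the interval between their centres would be free of zeros of [dh],
    against Rolle's theorem for [h].
    The window [[-2, pi + 2]] contains all arcs because [r <= 1]. *)
Lemma stable_zero_lines : exists2 m, 0 < m & forall k dk,
  (forall x : R, is_derive x 1 k (dk x)) -> continuous dk ->
  pi_equivariant d k ->
  (forall x, - 2 <= x <= pi + 2 -> `|k x - h x| < m /\ `|dk x - dh x| < m) ->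
  counting (zero_lines k) = #|I|%:R%:E :> \bar R.
Proof.
have pi2 := pi_ge2 R.
have [r [/andP[r0 r1] rP]] := simple_radius.
have [m1 m10 m1P] := nonzero_far r0.
have hc := derive_continuous hD.
have sgn i : h (w i - r) * h (w i + r) < 0 by exact: opposite_signs hD dhc r0 (h_w i) (rP i).
have [|m2 m20 m2P] := @finite_common_radius I (fun i m => [/\ m <= `|h (w i - r)|,
   m <= `|h (w i + r)| & forall x, `|x - w i| <= r -> m <= `|dh x|]).
  move=> i; have [|m m0 mP] := @segment_nonzero R dh (w i - r) (w i + r) dhc.
    by move=> x xw; apply: (rP i); rewrite ler_norml; lra.
  have h0 : h (w i - r) * h (w i + r) != 0 by rewrite lt_eqF.
  rewrite mulf_eq0 negb_or in h0; case/andP: h0 => hl hr.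
  exists (Num.min m (Num.min `|h (w i - r)| `|h (w i + r)|)).
    by rewrite !lt_min m0 !normr_gt0 hl hr.
  move=> e /andP[_]; rewrite !le_min => /and3P[em el er]; split=> // x xw.
  by apply: (le_trans em); apply: mP; move: xw; rewrite ler_norml; lra.
exists (Num.min m1 m2); first by rewrite lt_min m10.
move=> k dk kD dkc kd close.
have kc := derive_continuous kD.
have {}m2P i := m2P i m2 (introT andP (conj m20 (lexx m2))).
have hclose x : - 2 <= x <= pi + 2 -> `|k x - h x| < m1 /\ `|k x - h x| < m2.
  by move=> /close[]; rewrite lt_min => /andP[].
have dclose x : - 2 <= x <= pi + 2 -> `|dk x - dh x| < m2.
  by move=> /close[_]; rewrite lt_min => /andP[].
have arc i x : `|x - w i| <= r -> - 2 <= x <= pi + 2.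
  by rewrite ler_norml; have := w_pi i; lra.
have dk0 i x : `|x - w i| <= r -> dk x != 0.
  move=> xw; have [_ _ /(_ _ xw) dm] := m2P i; have := dclose _ (arc _ _ xw).
  by apply: contraTneq => ->; rewrite sub0r normrN -leNgt.
have /choice[z zP] : forall i, exists z, `|z - w i| <= r /\ k z = 0.
  move=> i; have wl : `|w i - r - w i| <= r by rewrite ler_norml; lra.
  have wr : `|w i + r - w i| <= r by rewrite ler_norml; lra.
  have [cl] := hclose _ (arc _ _ wl); have [cr] := hclose _ (arc _ _ wr).
  have [ml mr _] := m2P i => cr2 cl2.
  have [||z zP z0] := @zero_between R k (w i - r) (w i + r) kc; first by lra.
    have kl := same_sign ml cl2; have kr := same_sign mr cr2.
    by rewrite -(nmulr_rgt0 _ (sgn i)) mulrACA mulr_gt0.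
  by exists z; split=> //; rewrite ler_norml; lra.
have unique i x y : `|x - w i| <= r -> `|y - w i| <= r -> k x = 0 -> k y = 0 -> x = y.
  wlog xy : x y / x < y.
    by move=> H xw yw kx ky; case: (ltgtP x y) => // xy; [|apply/esym]; apply: H.
  move=> xw yw kx ky; have [|c cxy /eqP] := critical_between kD xy; first by rewrite kx ky.
  by rewrite (negbTE (dk0 i c _))//; move: xw yw; rewrite !ler_norml; lra.
have -> : zero_lines k = range (line \o z).
  apply/seteqP; split=> [_ [x [x0 kx] <-]|_ [i _ <-]]; last first.
    have [zw kz] := zP i; apply: mem_zero_lines kd _ kz; move: zw; rewrite ler_norml.
    by have := w_pi i; lra.
  have [[i [j xj]]|far] := pselect (exists i j, `|x + shift j - w i| < r); last first.
    have : m1 <= `|h x|.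
      by apply: m1P => // i j; rewrite leNgt; apply/negP => xij; apply: far; exists i, j.
    have [|c1 _] := hclose x; first by lra.
    by move: c1; rewrite kx sub0r normrN => c1; rewrite leNgt c1.
  exists i => //=; rewrite -(line_shift j x); congr line.
  have [zw kz] := zP i; apply: (unique i) => //; first exact: ltW.
  by apply/eqP; rewrite pi_hom_shift// kx.
apply: counting_range => i j /= zij.
have [zi _] := zP i; have [zj _] := zP j.
(* Both zeros are within [1] of [[0, pi]], so they differ by less than [2 * pi]. *)
have [s zs] : exists s, z i = z j + shift s.
  have wi := w_pi i; have wj := w_pi j; move: zi zj; rewrite !ler_norml => zi zj.
  have [small|far] := ltP (`|z i - z j|) pi.
    by exists (@Ordinal 3 1 isT); rewrite /shift/= subrr mul0r addr0; apply: line_inj.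
  have [lt|le] := ltP (z i) (z j).
    exists (@Ordinal 3 0 isT); rewrite /shift/= sub0r mulN1r.
    apply: line_inj; last by rewrite zij -[in LHS](subrK pi (z j)) line_addpi.
    by move: far; rewrite distrC gtr0_norm ?subr_gt0// ltr_norml; lra.
  exists (@Ordinal 3 2 isT); rewrite /shift/= -[2]/(1 + 1) addrK mul1r.
  apply: line_inj; last by rewrite zij line_addpi.
  by move: far; rewrite ger0_norm ?subr_ge0// ltr_norml; lra.
have [ij|ij] := eqVneq (w i) (w j + shift s).
  apply: wI; have := w_pi i; have := w_pi j; rewrite ij /shift.
  by case: s {zs ij} => [[|[|[|//]]] Hs] /=; lra.
(* [z i] belongs to the arcs around both zeros [w i] and [w j + shift s] of [h];
   if these differ, a critical point between them lies in one of the arcs. *)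
have hwj : h (w j + shift s) = 0 by apply/eqP; rewrite pi_hom_shift// h_w.
have [c cz dc0] : exists2 c, `|c - w i| <= r \/ `|c - shift s - w j| <= r & dh c = 0.
  move: zi zj; rewrite {}zs; move: (z j) => y.
  rewrite !ler_norml => zi zj.
  case: (ltgtP (w i) (w j + shift s)) ij => // ltw _.
    have [|c cw c0] := critical_between hD ltw; first by rewrite h_w.
    exists c => //; rewrite !ler_norml.
    by have [cy|cy] := leP c (y + shift s); [left|right]; lra.
  have [|c cw c0] := critical_between hD ltw; first by rewrite h_w.
  exists c => //; rewrite !ler_norml.
  by have [cy|cy] := leP c (y + shift s); [right|left]; lra.
exfalso; case: cz => /rP; first by rewrite dc0 eqxx.
by rewrite -(pi_hom_shift s _ dhd) subrK dc0 eqxx.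
Qed.

End Perturbation.
End Stability.

(** * Binary forms on the unit circle *)

Section Forms.
Context {R : realType}.
Implicit Types (f g : bpoly R) (d : nat).

Definition xvar : bpoly R := mpolyX R (mnm1 ord0).
Definition yvar : bpoly R := mpolyX R (mnm1 ord_max).

(** The restriction of [f] to the unit circle, as a function of the angle. *)
Definition circ f (x : R) : R := bevaluate f (direction x).

(** The derivative of [f] along the rotation field [(- y, x)].  It is again a form
    of the same degree, so that derivatives of all orders with respect to the
    angle remain restrictions of forms ([is_derive_circ]). *)
Definition dcirc f : bpoly R := xvar * mderiv ord_max f - yvar * mderiv ord0 f.

Lemma circD f g x : circ (f + g) x = circ f x + circ g x.
Proof. exact: mevalD. Qed.
Lemma circM f g x : circ (f * g) x = circ f x * circ g x.
Proof. exact: mevalM. Qed.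
Lemma circB f g x : circ (f - g) x = circ f x - circ g x.
Proof. exact: mevalB. Qed.
Lemma circZ c f x : circ (c *: f) x = c * circ f x.
Proof. exact: mevalZ. Qed.
Lemma circ_x x : circ xvar x = cos x.
Proof. by rewrite /circ /bevaluate mevalXU direction0. Qed.
Lemma circ_y x : circ yvar x = sin x.
Proof. by rewrite /circ /bevaluate mevalXU direction1. Qed.
Lemma circ1 x : circ 1 x = 1.
Proof. exact: meval1. Qed.
Lemma circ_sum (I : Type) (r : seq I) (F : I -> bpoly R) x :
  circ (\sum_(i <- r) F i) x = \sum_(i <- r) circ (F i) x.
Proof. exact: (raddf_sum (meval _)). Qed.

Lemma dcircD f g : dcirc (f + g) = dcirc f + dcirc g.
Proof. by rewrite /dcirc !mderivD; ring. Qed.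
Lemma dcircZ c f : dcirc (c *: f) = c *: dcirc f.
Proof. by rewrite /dcirc !mderivZ -!scalerAr scalerBr. Qed.
Lemma dcircM f g : dcirc (f * g) = dcirc f * g + f * dcirc g.
Proof. by rewrite /dcirc !mderivM; ring. Qed.
Lemma mderiv_var (i j : 'I_2) : mderiv i (mpolyX R (mnm1 j)) = (i == j)%:R.
Proof.
rewrite mderivX mnm1E eq_sym; case: eqVneq => [->|_]; last by rewrite scale0r.
rewrite scale1r (_ : mnm_sub _ _ = mnm0) ?mpolyX0//.
by apply/mnmP => k; rewrite !mnmE subnn.
Qed.
Lemma dcirc_x : dcirc xvar = - yvar.
Proof. by rewrite /dcirc !mderiv_var/= mulr0 mulr1 sub0r. Qed.
Lemma dcirc_y : dcirc yvar = xvar.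
Proof. by rewrite /dcirc !mderiv_var/= mulr0 mulr1 subr0. Qed.
Lemma dcirc0 : dcirc 0 = 0.
Proof. by apply: (addrI (dcirc 0)); rewrite -dcircD !addr0. Qed.
Lemma dcirc1 : dcirc 1 = 0.
Proof.
by apply: (addrI (dcirc 1)); rewrite -[in RHS](mul1r 1) dcircM mulr1 mul1r addr0.
Qed.

Lemma form_ind (P : bpoly R -> Prop) : P 1 -> P xvar -> P yvar ->
  (forall f g, P f -> P g -> P (f * g)) -> (forall c f, P f -> P (c *: f)) ->
  (forall f g, P f -> P g -> P (f + g)) -> forall f, P f.
Proof.
move=> P1 Px Py PM PZ PD f; rewrite [f]mpolyE.
apply: big_ind => [||m _]; [by rewrite -(scale0r 1); exact: PZ|exact: PD|apply: PZ].
rewrite mpolyXE_id big_ord_recl big_ord1.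
have Pexp g n : P g -> P (g ^+ n).
  by move=> Pg; elim: n => [|n IHn]; rewrite ?expr0// exprS; exact: PM.
by apply: PM; apply: Pexp.
Qed.

Lemma is_derive_circ f (x : R) : is_derive x 1 (circ f) (circ (dcirc f) x).
Proof.
have evE g h : (forall x, circ g x = h x) -> circ g = h by move=> gh; apply/funext.
move: f; apply: form_ind.
- rewrite dcirc1 (evE _ (cst 1) circ1) (_ : circ 0 x = 0); first exact: is_derive_cst.
  exact: meval0.
- rewrite dcirc_x (evE _ cos circ_x) (_ : circ _ x = - sin x); first exact: is_derive_cos.
  by rewrite -circ_y; exact: mevalN.
- by rewrite dcirc_y (evE _ sin circ_y) circ_x; exact: is_derive_sin.
- move=> f g df dg; rewrite (evE _ (circ f * circ g)); last exact: circM.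
  apply: is_derive_eq; rewrite dcircM (circD (dcirc f * g)) (circM (dcirc f)) (circM f).
  by rewrite addrC /GRing.scale/= [circ g x * _]mulrC.
- move=> c f df; rewrite (evE _ (c \*: circ f)); last exact: circZ.
  by rewrite dcircZ circZ; exact: is_deriveZ.
- move=> f g df dg; rewrite (evE _ (circ f + circ g)); last exact: circD.
  by rewrite dcircD (circD (dcirc f)); exact: is_deriveD.
Qed.

Lemma continuous_circ f : continuous (circ f).
Proof. exact: derive_continuous (is_derive_circ f). Qed.

Lemma form_xvar : binary_form 1 xvar.
Proof. by rewrite /binary_form/= dhomogX; apply/eqP; exact: mdeg1. Qed.
Lemma form_yvar : binary_form 1 yvar.
Proof. by rewrite /binary_form/= dhomogX; apply/eqP; exact: mdeg1. Qed.
Lemma form1 : binary_form 0 (1 : bpoly R).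
Proof. exact: dhomog1. Qed.
Lemma formD d f g : binary_form d f -> binary_form d g -> binary_form d (f + g).
Proof. exact: dhomogD. Qed.
Lemma formZ d c f : binary_form d f -> binary_form d (c *: f).
Proof. exact: dhomogZ. Qed.
Lemma formN d f : binary_form d f -> binary_form d (- f).
Proof. by move=> fd; rewrite -scaleN1r; exact: formZ. Qed.
Lemma formM d e f g : binary_form d f -> binary_form e g -> binary_form (d + e) (f * g).
Proof. exact: dhomogM. Qed.
Lemma formX d f k : binary_form d f -> binary_form (d * k) (f ^+ k).
Proof. exact: dhomogMn. Qed.
Lemma form_sum d (I : eqType) (r : seq I) (F : I -> bpoly R) :
  (forall i, i \in r -> binary_form d (F i)) -> binary_form d (\sum_(i <- r) F i).
Proof.
move=> Fd; rewrite big_seq; apply: big_ind => //; first exact: dhomog0.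
exact: formD.
Qed.

Lemma dcirc_form d f : binary_form d f -> binary_form d (dcirc f).
Proof.
have key e g k : binary_form 1 g -> binary_form 1 (dcirc g) -> e = k ->
    binary_form e (g ^+ k) /\ binary_form e (dcirc (g ^+ k)).
  move=> g1 dg1 ->; elim: k => [|k [gk dgk]].
    by rewrite expr0 dcirc1; split; [exact: form1|exact: dhomog0].
  rewrite exprS dcircM -add1n; split; first exact: formM.
  by apply: formD; exact: formM.
move=> /dhomogP fd; rewrite [f]mpolyE.
have -> : dcirc (\sum_(m <- msupp f) mcoeff m f *: mpolyX R m) =
    \sum_(m <- msupp f) mcoeff m f *: dcirc (mpolyX R m).
  elim/big_rec2: _ => [|m g h _ IH]; first exact: dcirc0.
  by rewrite dcircD IH dcircZ.
apply: form_sum => m /fd md; apply: formZ.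
have {md}-> : d = (m ord0 + m (lift ord0 ord0))%N.
  by rewrite -md; have := mdegE m; rewrite big_ord_recl big_ord1 => <-.
rewrite mpolyXE_id big_ord_recl big_ord1.
have [|x1 dx1] := key (m ord0) xvar _ form_xvar _ erefl.
  by rewrite dcirc_x; exact: formN form_yvar.
have [|y1 dy1] := key (m (lift ord0 ord0)) yvar _ form_yvar _ erefl.
  by rewrite dcirc_y; exact: form_xvar.
have -> : mnm1 (lift ord0 ord0) = mnm1 ord_max :> multinom 2.
  by congr mnm1; exact: val_inj.
by rewrite dcircM; exact: formD (formM dx1 y1) (formM x1 dy1).
Qed.

Lemma bevaluate_scale d f (r : R) v : binary_form d f ->
  bevaluate f (r *: v) = r ^+ d * bevaluate f v.
Proof.
move=> /dhomogP fd; rewrite /bevaluate !mevalE mulr_sumr [LHS]big_seq [RHS]big_seq.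
apply: eq_bigr => m /fd md; rewrite mulrCA; congr (_ * _).
have -> : d = (\sum_i m i)%N by rewrite -md; exact: mdegE.
rewrite expr_sum -big_split/=.
by apply: eq_bigr => i _; rewrite mxE exprMn.
Qed.

(** [dcirc f] at [v] is the determinant of [v] and [gradient f v]; it vanishes iff
    the gradient is a multiple of the nonzero vector [v]. *)
Lemma eigenvectors_dcirc f : real_eigenvectors f = real_roots (dcirc f).
Proof.
rewrite /real_eigenvectors /real_roots; congr (_ @` _); apply/seteqP.
have E v : bevaluate (dcirc f) v =
    v ord0 ord0 * bevaluate (mderiv ord_max f) v
    - v ord0 ord_max * bevaluate (mderiv ord0 f) v.
  by rewrite /bevaluate mevalB !mevalM !mevalXU.
split=> v /= [v0]; rewrite E; last first.
  set a := bevaluate (mderiv ord0 f) v; set b := bevaluate (mderiv ord_max f) v.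
  set p := v ord0 ord0; set q := v ord0 ord_max => /eqP; rewrite subr_eq0 => /eqP pq.
  split=> //; have [p0|p0] := eqVneq p 0.
    have q0 : q != 0.
      by apply: contraNneq v0 => q0; apply/eqP/row2P; rewrite mxE.
    exists (b / q); apply: row2P; rewrite !mxE -/p -/q -/a -/b ?divfK//.
    rewrite p0 mulr0; apply/eqP; move/esym/eqP: pq.
    by rewrite p0 mul0r mulf_eq0 (negbTE q0).
  exists (a / p); apply: row2P; rewrite !mxE -/p -/q -/a -/b ?divfK//.
  by rewrite mulrAC [a * q]mulrC -pq mulrAC mulfV// mul1r.
move=> [l gl]; split=> //.
have : gradient f v ord0 ord0 = l * v ord0 ord0 by rewrite gl mxE.
have : gradient f v ord0 ord_max = l * v ord0 ord_max by rewrite gl mxE.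
by rewrite !mxE => -> ->; ring.
Qed.

Lemma pi_equivariant_circ d f : binary_form d f -> pi_equivariant d (circ f).
Proof.
move=> fd x; rewrite /circ -(bevaluate_scale (-1) _ fd); congr bevaluate.
by apply: row2P; rewrite [RHS]mxE ?direction0 ?direction1 ?cosDpi ?sinDpi mulN1r.
Qed.

Lemma real_roots_zero_lines d f : binary_form d f ->
  real_roots f = zero_lines (circ f).
Proof.
move=> fd; apply/seteqP; split=> [_ [v [v0 fv]] <-|_ [x [x0 fx]] <-]; last first.
  by exists (direction x) => //; split=> //; exact: direction_neq0.
have [x [r [x0 r0 vE]]] := line_surj v0; exists x.
  split=> //; apply/eqP; move: fv; rewrite vE (bevaluate_scale _ _ fd) => /eqP.
  by rewrite mulf_eq0 expf_eq0 (negbTE r0) andbF.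
rewrite vE /line; apply/eqP; rewrite eqEsubv -!memvE.
apply/andP; split; apply/vlineP; [exists r^-1|by exists r].
by rewrite scalerA mulVf// scale1r.
Qed.

End Forms.

(** * Measurability of the number of zeros *)

Section Measurability.

Lemma exists_invn {R : realType} (e : R) : 0 < e -> exists n, n.+1%:R^-1 < e.
Proof.
move=> e0; exists (Num.truncn e^-1); rewrite invf_plt ?posrE//.
have e'0 : 0 <= e^-1 by rewrite invr_ge0 ltW.
by case/andP: (truncn_itv e'0).
Qed.

Context {R : realType} (N : nat) (phi : 'I_N -> R -> R).
Definition lincomb (a : N.-tuple R) (x : R) : R := \sum_i tnth a i * phi i x.

Hypothesis continuous_lincomb : forall a, continuous (lincomb a).

(** By compactness of the segment, there is a zero iff the values at countably many
    points of the segment come arbitrarily close to [0].  The values are linear,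
    hence measurable, in the coefficients [a]. *)
Lemma measurable_zero_in_segment u v :
  measurable [set a | exists2 x, u <= x <= v & lincomb a x = 0].
Proof.
have [uv|vu] := leP u v; last first.
  rewrite (_ : [set _ | _] = set0)//; apply/seteqP; split=> // a [x /andP[ux xv] _].
  by have := le_trans ux xv; rewrite leNgt vu.
(* Rational numbers are clamped into the segment, which may be a single point. *)
pose c (q : rat) : R := Num.max u (Num.min v (ratr q)).
have -> : [set a | exists2 x, u <= x <= v & lincomb a x = 0] =
    \bigcap_n \bigcup_q [set a | `|lincomb a (c q)| < n.+1%:R^-1].
  apply/seteqP; split=> [a [x xuv ax] n _|a H].
    have n0 : 0 < n.+1%:R^-1 :> R by rewrite invr_gt0.
    have /cvgrPdist_lt/(_ _ n0) := @continuous_lincomb a x.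
    rewrite ax => /nbhs_ballP[e /= e0 eP].
    have xe : x - e < x + e by lra.
    have [q] := rat_in_itvoo xe; rewrite in_itv/= => qx; exists q => //=.
    have := eP (c q); rewrite sub0r normrN; apply; rewrite /ball/= ltr_norml /c.
    by rewrite /Num.max /Num.min; case: ifP; case: ifP => /negP; lra.
  apply: contrapT => nz.
  have [|m m0 mP] := @segment_nonzero R (lincomb a) u v (@continuous_lincomb a).
    by move=> x xuv; apply/eqP => ax; apply: nz; exists x.
  have [n nm] := exists_invn m0; have [q _ /=] := H n Logic.I.
  apply/negP; rewrite -leNgt (le_trans (ltW nm))// mP// /c.
  by rewrite le_max lexx ge_max uv ge_min lexx.
apply: bigcapT_measurable => n; apply: bigcupT_measurable_rat => q.
have mf : measurable_fun setT (fun a => lincomb a (c q)).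
  apply: measurable_sum => i; apply: measurable_funM; last exact: measurable_cst.
  exact: measurable_tnth.
rewrite (_ : [set a | _] =
    setT `&` (fun a => lincomb a (c q)) @^-1` `]-n.+1%:R^-1, n.+1%:R^-1[).
  by apply: mf => //; exact: measurable_itv.
by apply/seteqP; split=> a /=; rewrite in_itv/= ltr_norml//; case.
Qed.

Lemma measurable_zero_in_half_open u v :
  measurable [set a | exists2 x, u <= x < v & lincomb a x = 0].
Proof.
have -> : [set a | exists2 x, u <= x < v & lincomb a x = 0] =
    \bigcup_n [set a | exists2 x, u <= x <= v - n.+1%:R^-1 & lincomb a x = 0].
  apply/seteqP; split=> [a [x /andP[ux xv] ax]|a [n _ [x /andP[ux xv] ax]]].
    have vx : 0 < v - x by rewrite subr_gt0.
    have [n nP] := exists_invn vx.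
    by exists n => //; exists x => //; rewrite ux lerBrDr -lerBrDl ltW.
  exists x => //; rewrite ux (le_lt_trans xv)// gtrBl invr_gt0//.
by apply: bigcupT_measurable => n; exact: measurable_zero_in_segment.
Qed.

(** The half-open cells partition [0, pi), so zeros in different cells are
    distinct; conversely, distinct zeros are separated by a fine enough partition. *)
Definition cell n j : set R :=
  [set x : R | j%:R * pi / n.+1%:R <= x < j.+1%:R * pi / n.+1%:R].

Lemma cell_exists n (x : R) : 0 <= x < pi -> exists j : 'I_n.+1, cell n j x.
Proof.
move=> /andP[x0 xpi]; have pi0 := pi_gt0 R; have n0 : 0 < n.+1%:R :> R by [].
pose y := x * n.+1%:R / pi.
have y0 : 0 <= y by rewrite divr_ge0 ?mulr_ge0// ltW.
have /andP[jy yj] := truncn_itv y0.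
have jn : (Num.truncn y < n.+1)%N.
  rewrite -(ltr_nat R) (le_lt_trans jy)// /y ltr_pdivrMr// mulrC ltr_pM2l//.
exists (Ordinal jn); rewrite /cell/= ler_pdivrMr// ltr_pdivlMr//.
by rewrite -ler_pdivlMr// jy -ltr_pdivrMr.
Qed.

Lemma cell_uniq n j k x : cell n j x -> cell n k x -> j = k.
Proof.
have n0 : 0 < n.+1%:R :> R by [].
have lejk j1 k1 : cell n j1 x -> cell n k1 x -> (j1 <= k1)%N.
  move=> /andP[jx _] /andP[_ xk]; rewrite -ltnS -(ltr_nat R).
  have := le_lt_trans jx xk; rewrite ltr_pM2r ?invr_gt0// ltr_pM2r//; exact: pi_gt0.
by move=> jx kx; apply/eqP; rewrite eqn_leq !lejk.
Qed.

Lemma cell_pi n (j : 'I_n.+1) x : cell n j x -> 0 <= x < pi.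
Proof.
have pi0 := pi_gt0 R; have n0 : 0 < n.+1%:R :> R by [].
move=> /andP[jx xj]; apply/andP; split.
  by apply: le_trans jx; rewrite divr_ge0// mulr_ge0// ltW.
apply: (lt_le_trans xj); rewrite ler_pdivrMr// mulrC ler_pM2l// ler_nat.
exact: ltn_ord.
Qed.

(** There are at least [k] zero lines iff, for some partition, [k] distinct cells
    contain a zero. *)
Lemma measurable_counting_ge k :
  measurable [set a | (k%:R%:E <= counting (zero_lines (lincomb a)) :> \bar R)%E].
Proof.
have -> : [set a | (k%:R%:E <= counting (zero_lines (lincomb a)) :> \bar R)%E] =
  \bigcup_n \bigcup_(g in [set g : {ffun 'I_k -> 'I_n.+1} | injective g])
   \bigcap_(i in [set: 'I_k])
     [set a | exists2 x, cell n (g i) x & lincomb a x = 0].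
  apply/seteqP; split=> [a /= /counting_geP[w [wi wz]]|a [n _ [g ginj ga]]]; last first.
    apply/counting_geP.
    have /choice[x xP] : forall i, exists x, cell n (g i) x /\ lincomb a x = 0.
      by move=> i; have [x] := ga i Logic.I; exists x.
    exists (line \o x); split=> [i j /= xij|i]; last first.
      by exists (x i) => //; split; [exact: cell_pi (xP i).1|exact: (xP i).2].
    apply: ginj; apply/val_inj; apply: (cell_uniq (xP i).1).
    suff -> : x i = x j by exact: (xP j).1.
    by apply: line_inj_half_open xij; [exact: cell_pi (xP i).1|exact: cell_pi (xP j).1].
  have /choice[x xP] : forall i, exists x, (0 <= x < pi /\ lincomb a x = 0) /\ line x = w i.
    by move=> i; have [x xP xw] := wz i; exists x.
  have xinj : injective x by move=> i j xij; apply: wi; rewrite -(xP i).2 -(xP j).2 xij.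
  have [|e e0 eP] := @finite_common_radius R ('I_k * 'I_k)%type
     (fun p e => p.1 != p.2 -> e <= `|x p.1 - x p.2|).
    move=> [i j]; have [->|ij] := eqVneq i j; first by exists 1.
    exists `|x i - x j|; last by move=> e' /andP[].
    by rewrite normr_gt0 subr_eq0; apply: contra ij => /eqP/xinj ->.
  have [n nP] : exists n, pi / n.+1%:R < e.
    have [n nP] := exists_invn (divr_gt0 e0 (pi_gt0 R)).
    by exists n; rewrite mulrC -ltr_pdivlMr// pi_gt0.
  have /choice[g gP] : forall i, exists j : 'I_n.+1, cell n j (x i).
    by move=> i; apply: cell_exists; case: (xP i) => -[].
  exists n => //; exists [ffun i => g i]; last first.
    by move=> i _; exists (x i); rewrite ?ffunE//; exact: (xP i).1.2.
  move=> i j; rewrite !ffunE => gij; apply/eqP/negPn/negP => ij.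
  have ee : 0 < e <= e by rewrite e0 lexx.
  have := eP (i, j) e ee ij => /=; apply/negP; rewrite -ltNge.
  have := gP j; have := gP i; rewrite gij /cell/= -[(g j).+1%:R]natr1 !mulrDl mul1r.
  move: (_ * pi / _) nP => J.
  move: (pi / _) => P nP /andP[i1 i2] /andP[j1 j2].
  by rewrite ltr_norml; lra.
apply: bigcupT_measurable => n; apply: fin_bigcup_measurable; first exact: finite_finset.
move=> g _; apply: fin_bigcap_measurable; first exact: finite_finset.
by move=> i _; exact: measurable_zero_in_half_open.
Qed.

End Measurability.

(** * Linear families of forms *)

Section FormFamilies.
Context {R : realType} (N d : nat) (B : 'I_N -> bpoly R).
Hypothesis B_form : forall i, binary_form d (B i).

(** The family [B] is taken arbitrary because two are needed: the monomials, which
    control the roots of a form, and their images under [dcirc], which control its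
    eigenvectors in terms of the same coefficients. *)
Definition span_form (a : N.-tuple R) : bpoly R := \sum_i tnth a i *: B i.

Lemma circ_span_form a : circ (span_form a) = lincomb (fun i => circ (B i)) a.
Proof.
by apply/funext => x; rewrite circ_sum; apply: eq_bigr => i _; rewrite circZ.
Qed.

Lemma span_form_form a : binary_form d (span_form a).
Proof. by apply: form_sum => i _; exact: formZ. Qed.

Lemma measurable_real_roots_eq k :
  measurable [set a | counting (real_roots (span_form a)) = k%:R%:E :> \bar R].
Proof.
pose G k := [set a | (k%:R%:E <= counting (real_roots (span_form a)) :> \bar R)%E].
have mG j : measurable (G j).
  rewrite /G; under eq_set => a do
    rewrite (real_roots_zero_lines (span_form_form a)) circ_span_form.
  by apply: measurable_counting_ge => a; rewrite -circ_span_form; exact: continuous_circ.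
rewrite (_ : [set _ | _] = G k `&` ~` G k.+1).
  by apply: measurableI; [|apply: measurableC]; exact: mG.
by apply/seteqP; split=> a; [move/counting_eqP|move=> H; exact/counting_eqP].
Qed.

Lemma circ_span_form_close (a : N.-tuple R) (u v m : R) : 0 < m ->
  exists2 e, 0 < e & forall b, (forall i, `|tnth b i - tnth a i| < e) ->
    forall x, u <= x <= v -> `|circ (span_form b) x - circ (span_form a) x| < m.
Proof.
move=> m0.
have /choice[M MP] : forall i, exists M, 0 < M /\ forall x, u <= x <= v -> `|circ (B i) x| <= M.
  by move=> i; have [M M0 MP] := @segment_bounded R _ u v (@continuous_circ R (B i)); exists M.
pose S := 1 + \sum_i M i.
have S0 : 0 < S by rewrite ltr_pwDl// sumr_ge0// => i _; rewrite ltW//; case: (MP i).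
exists (m / S); first exact: divr_gt0.
move=> b ba x xuv; rewrite !circ_span_form /lincomb -sumrB.
apply: (le_lt_trans (ler_norm_sum _ _ _)).
apply: (@le_lt_trans _ _ (\sum_i m / S * M i)).
  apply: ler_sum => i _; rewrite -mulrBl normrM.
  by apply: ler_pM => //; [exact/ltW/ba|exact: (MP i).2].
rewrite -mulr_sumr mulrAC ltr_pdivrMr// ltr_pM2l// /S; lra.
Qed.

End FormFamilies.

Section StableForms.
Context {R : realType} (N d : nat) (B : 'I_N -> bpoly R).
Hypothesis B_form : forall i, binary_form d (B i).

Lemma dcirc_span_form a : dcirc (span_form B a) = span_form (dcirc \o B) a.
Proof.
rewrite /span_form; elim/big_rec2: _ => [|i f g _ IH]; first exact: dcirc0.
by rewrite dcircD dcircZ IH.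
Qed.

Lemma stable_real_roots (I : finType) (w : I -> R) (a : N.-tuple R) :
  injective w -> (forall i, 0 <= w i < pi) ->
  (forall i, circ (span_form B a) (w i) = 0) ->
  (forall i, circ (dcirc (span_form B a)) (w i) != 0) ->
  (forall x, 0 <= x < pi -> circ (span_form B a) x = 0 -> exists i, x = w i) ->
  exists2 e, 0 < e & forall b, (forall i, `|tnth b i - tnth a i| < e) ->
    counting (real_roots (span_form B b)) = #|I|%:R%:E :> \bar R.
Proof.
move=> wI wpi w0 w1 wall.
have Fd b := span_form_form B_form b.
have [m m0 mP] := stable_zero_lines (is_derive_circ _) (@continuous_circ _ _)
  (pi_equivariant_circ (Fd a)) (pi_equivariant_circ (dcirc_form (Fd a))) wI wpi w0 w1 wall.
have [e1 e10 e1P] := @circ_span_form_close R N B a (-2) (pi + 2) m m0.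
have [e2 e20 e2P] := @circ_span_form_close R N (dcirc \o B) a (-2) (pi + 2) m m0.
exists (Num.min e1 e2); first by rewrite lt_min e10.
move=> b ba; rewrite (real_roots_zero_lines (Fd b)).
apply: mP (is_derive_circ _) (@continuous_circ _ _) (pi_equivariant_circ (Fd b)) _.
move=> x xP; rewrite !dcirc_span_form; split; [apply: e1P xP|apply: e2P xP] => i;
  by have := ba i; rewrite lt_min => /andP[].
Qed.

End StableForms.
(** * Coefficients as coordinates *)

Section Coordinates.
Context {R : realType} (d : nat).
Implicit Types (f : bpoly R) (a b : d.+1.-tuple R).

Definition monomial (i : 'I_d.+1) : bpoly R :=
  mpolyX R (Multinom [tuple (i : nat); (d - i)%N]).

Definition form_of a : bpoly R := span_form monomial a.

Lemma form_monomial i : binary_form d (monomial i).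
Proof.
rewrite /binary_form/= dhomogX; apply/eqP; rewrite [LHS]mdegE big_ord_recl big_ord1.
by rewrite !multinomE/= (tnth_nth 0%N)/= subnKC// -ltnS.
Qed.

Lemma form_of_form a : binary_form d (form_of a).
Proof. exact: span_form_form form_monomial a. Qed.

Lemma mcoeff_monomial m i :
  mcoeff m (monomial i) = ((mdeg m == d) && (m ord0 == i))%:R.
Proof.
rewrite mcoeffX; congr ((nat_of_bool _)%:R); apply/idP/idP.
  move=> /eqP <-; have := form_monomial i; rewrite /binary_form/= dhomogX => /eqP md.
  by apply/andP; split; [apply/eqP; exact: md|rewrite multinomE].
move=> /andP[/eqP md /eqP mi].
apply/eqP/mnmP => -[[|[|//]] Hi]; rewrite multinomE !(tnth_nth 0%N)/=.
  by rewrite -mi; congr (m _); exact: val_inj.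
rewrite -mi -md mdegE big_ord_recl big_ord1 addKn; congr (m _); exact: val_inj.
Qed.

Lemma mcoeff_form_of m a (i : 'I_d.+1) : mdeg m = d -> m ord0 = i ->
  mcoeff m (form_of a) = tnth a i.
Proof.
move=> md mi; rewrite /form_of /span_form raddf_sum/= (bigD1 i)//= mcoeffZ mcoeff_monomial.
rewrite md mi !eqxx mulr1 big1 ?addr0// => j ji.
rewrite mcoeffZ mcoeff_monomial mi [(i : nat) == j]eq_sym.
by rewrite (_ : (j : nat) == i = false) ?andbF ?mulr0//; exact/negbTE.
Qed.

Lemma form_coordsK a : form_coords d (form_of a) = a.
Proof.
apply: eq_from_tnth => i; rewrite tnth_mktuple; apply: mcoeff_form_of.
  by have := form_monomial i; rewrite /binary_form/= dhomogX => /eqP.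
by rewrite multinomE.
Qed.

Lemma form_ofK f : binary_form d f -> form_of (form_coords d f) = f.
Proof.
move=> fd; apply/mpolyP => m.
have [md|md] := eqVneq (mdeg m) d; last first.
  by rewrite (dhomog_nemf_coeff fd md) (dhomog_nemf_coeff (form_of_form _) md).
have m0d : (m ord0 < d.+1)%N.
  by rewrite ltnS -md mdegE big_ord_recl leq_addr.
rewrite (@mcoeff_form_of m _ (Ordinal m0d))// tnth_mktuple; congr (mcoeff _ f).
apply/mnmP => -[[|[|//]] Hi]; rewrite multinomE !(tnth_nth 0%N)/=.
  by congr (m _); exact: val_inj.
rewrite -[in LHS]md mdegE big_ord_recl big_ord1 addKn; congr (m _); exact: val_inj.
Qed.

Lemma image_form_coords (P : bpoly R -> Prop) :
  form_coords d @` [set f | binary_form d f /\ P f] = [set a | P (form_of a)].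
Proof.
apply/seteqP; split=> [_ [f [fd Pf] <-]|a Pa] /=; first by rewrite form_ofK.
by exists (form_of a); [split=> //; exact: form_of_form|exact: form_coordsK].
Qed.

End Coordinates.

(** * Sets of positive volume *)

Import HBNNSimple.

Section Volume.
Context {R : realType}.

Lemma lebesgue_tuple_ge0 n (A : set (n.-tuple R)) : (0 <= lebesgue_tuple A)%E.
Proof.
elim: n A => [|n IHn] A /=; first exact: measure_ge0.
by rewrite /pushforward /product_measure1; apply: integral_ge0 => x _; exact: IHn.
Qed.

(** The integral of a nonnegative function is a supremum over the simple functions
    below it, which bounds it from below even if it is not measurable. *)
Lemma ge0_integral_ge_step (f : R -> \bar R) (a b c : R) :
  a < b -> 0 <= c -> (forall x, 0 <= f x)%E ->
  (forall x, a < x < b -> (c%:E <= f x)%E) ->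
  ((c * (b - a))%:E <= \int[@lebesgue_measure R]_x f x)%E.
Proof.
move=> ab c0 f0 fc; have mab : measurable (`]a, b[ : set (measurableTypeR R)).
  exact: measurable_itv.
pose g := scale_nnsfun (indic_nnsfun R mab) c0.
have -> : (c * (b - a))%:E = sintegral (@lebesgue_measure R) g.
  transitivity (sintegral (@lebesgue_measure R) (cst c \* indic_nnsfun R mab)%R); last by [].
  rewrite (@sintegralrM _ _ _ (@lebesgue_measure R) c (indic_nnsfun R mab)).
  rewrite sintegral_indic// EFinM; congr (_ * _)%E; apply/esym.
  have lab := lebesgue_measure_itv `]a, b[; rewrite /= lte_fin ab -EFinB in lab.
  exact: lab.
rewrite ge0_integralTE//; apply: ereal_sup_ubound; exists g => // x.
have -> : g x = c * (x \in [set` `]a, b[])%:R by rewrite -indicE.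
case: (boolP (x \in _)) => xab; last by rewrite mulr0.
by rewrite mulr1 fc//; move: xab; rewrite inE/= in_itv.
Qed.

(** The constant must not depend on [A]: in the induction it bounds the volumes of
    the slices of [A] uniformly over an interval of first coordinates. *)
Lemma lebesgue_tuple_box n (a : n.-tuple R) e : 0 < e ->
  exists2 c, 0 < c & forall A : set (n.-tuple R),
    (forall b, (forall i, `|tnth b i - tnth a i| < e) -> A b) ->
    (c%:E <= lebesgue_tuple A)%E.
Proof.
move=> e0; elim: n a => [|n IHn] a.
  exists 1 => // A aA /=; rewrite diracE; case: (boolP (_ \in A)) => //.
  by rewrite notin_setE => nA; exfalso; apply: nA; apply: aA => -[].
have [c c0 cP] := IHn [tuple of behead a].
exists (c * (e *+ 2)); first by rewrite mulr_gt0// mulrn_wgt0.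
move=> A aA /=; rewrite /pushforward /product_measure1.
have -> : e *+ 2 = (tnth a ord0 + e) - (tnth a ord0 - e) by rewrite mulr2n; ring.
apply: ge0_integral_ge_step; [by lra|exact: ltW|by move=> x; exact: lebesgue_tuple_ge0|].
move=> x xa; apply: cP => b ba; rewrite /xsection/= inE/=; apply: aA => i.
have [->|[j ->]] : i = ord0 \/ exists j, i = lift ord0 j.
  by have [j ->|->] := unliftP ord0 i; [right; exists j|left].
  by rewrite tnth0 ltr_norml; lra.
have -> : tnth a (lift ord0 j) = tnth [tuple of behead a] j.
  by rewrite !(tnth_nth 0) nth_behead.
by rewrite tnthS.
Qed.

End Volume.


(** * Log-concavity on the circle *)

Section LogConcavity.
Context {R : realType}.
Implicit Types (f g : bpoly R).

(** On the circle, [- laguerre f / f ^+ 2] is the second derivative of [ln `|f|]. *)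
Definition laguerre f : bpoly R := dcirc f ^+ 2 - f * dcirc (dcirc f).

(** Dividing by [(f * g) ^+ 2], this is the additivity of logarithmic derivatives. *)
Lemma laguerreM f g : laguerre (f * g) = f ^+ 2 * laguerre g + g ^+ 2 * laguerre f.
Proof. by rewrite /laguerre !(dcircM, dcircD); ring. Qed.

Lemma circN f x : circ (- f) x = - circ f x.
Proof. exact: mevalN. Qed.

Lemma circX f k x : circ (f ^+ k) x = circ f x ^+ k.
Proof. by elim: k => [|k IHk]; rewrite ?expr0 ?circ1// !exprS circM IHk. Qed.

Lemma circ_laguerre f x :
  circ (laguerre f) x = circ (dcirc f) x ^+ 2 - circ f x * circ (dcirc (dcirc f)) x.
Proof. by rewrite /laguerre circB circM circX. Qed.

Lemma circ_laguerreM f g x : circ (laguerre (f * g)) x =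
  circ f x ^+ 2 * circ (laguerre g) x + circ g x ^+ 2 * circ (laguerre f) x.
Proof. by rewrite laguerreM circD !circM. Qed.

Definition log_concave f := forall x, 0 <= circ (laguerre f) x.

Definition strictly_log_concave f :=
  log_concave f /\ forall x, circ f x != 0 -> 0 < circ (laguerre f) x.

Lemma log_concaveM f g : log_concave f -> log_concave g -> log_concave (f * g).
Proof.
by move=> fc gc x; rewrite circ_laguerreM addr_ge0// mulr_ge0 ?sqr_ge0.
Qed.

Lemma strictly_log_concaveM f g :
  strictly_log_concave f -> log_concave g -> strictly_log_concave (f * g).
Proof.
move=> [fc fs] gc; split=> [|x]; first exact: log_concaveM.
rewrite circM mulf_eq0 negb_or => /andP[f0 g0].
rewrite circ_laguerreM; apply: ltr_wpDl; first by rewrite mulr_ge0 ?sqr_ge0.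
by rewrite mulr_gt0 ?fs// exprn_even_gt0.
Qed.

(** The logarithmic derivative of [f] is strictly decreasing where [f] has no
    zero. *)
Lemma critical_uniq f u v x y : strictly_log_concave f ->
  (forall c, u < c < v -> circ f c != 0) ->
  u < x < v -> u < y < v -> circ (dcirc f) x = 0 -> circ (dcirc f) y = 0 -> x = y.
Proof.
move=> [_ fs] f0; wlog xy : x y / x < y.
  by move=> H xP yP dx dy; case: (ltgtP x y) => // xy; [|apply/esym]; apply: H.
move=> xP yP dx dy.
pose h c := circ (dcirc f) c / circ f c.
have hD c : x <= c <= y -> is_derive c 1 h (- circ (laguerre f) c / circ f c ^+ 2).
  move=> cP; have fc0 : circ f c != 0 by apply: f0; lra.
  have fD := is_derive_circ f c; have dfD := is_derive_circ (dcirc f) c.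
  have -> : h = circ (dcirc f) * (fun c => (circ f c)^-1) by apply/funext.
  have VD := is_deriveV fc0 fD.
  apply: is_derive_eq; rewrite circ_laguerre /GRing.scale/=.
  by field.
have [| | |c] := @Rolle R h x y xy.
- by move=> c; rewrite in_itv/= => cP; have [] := hD c _; first lra.
- apply: derivable_within_continuous => c; rewrite in_itv/= => cP; by have [] := hD c cP.
- by rewrite /h dx dy !mul0r.
rewrite in_itv/= => cP [_ hc0]; have [|_] := hD c; first lra.
have fc0 : circ f c != 0 by apply: f0; lra.
rewrite hc0 => /esym/eqP; rewrite mulf_eq0 invr_eq0 sqrf_eq0 (negbTE fc0) orbF oppr_eq0.
by rewrite gt_eqF// fs.
Qed.

(** At a critical point of [g], the restriction of [laguerre f] reduces to [- g * g'']. *)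
Lemma critical_nondegenerate f x : strictly_log_concave f -> circ f x != 0 ->
  circ (dcirc f) x = 0 -> circ (dcirc (dcirc f)) x != 0.
Proof.
move=> [_ fs] f0 d0; have := fs x f0; rewrite circ_laguerre d0 expr0n sub0r.
by apply: contraTneq => ->; rewrite mulr0 oppr0 ltxx.
Qed.

End LogConcavity.

(** * Products of linear forms *)

Section LinearFactors.
Context {R : realType}.
Implicit Types (f : bpoly R) (r : seq R).

(** [sqnorm] is constant on the circle; its powers adjust degrees without affecting
    any restriction to the circle. *)
Definition sqnorm : bpoly R := xvar ^+ 2 + yvar ^+ 2.

Lemma circ_sqnorm k x : circ (sqnorm ^+ k) x = 1.
Proof. by rewrite circX /sqnorm circD !circX circ_x circ_y cos2Dsin2 expr1n. Qed.

Lemma dcirc_sqnorm k : dcirc (sqnorm ^+ k) = 0.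
Proof.
have drho : dcirc sqnorm = 0 by rewrite /sqnorm !expr2 dcircD !dcircM dcirc_x dcirc_y; ring.
elim: k => [|k IHk]; first by rewrite expr0 dcirc1.
by rewrite exprS dcircM IHk drho mul0r mulr0 addr0.
Qed.

Lemma form_sqnorm k : binary_form (2 * k) (sqnorm ^+ k).
Proof. by apply: formX; apply: formD; [exact: (formX 2 form_xvar)|exact: (formX 2 form_yvar)]. Qed.

Lemma circ_mul_sqnorm f k x : circ (f * sqnorm ^+ k) x = circ f x.
Proof. by rewrite circM circ_sqnorm mulr1. Qed.

Lemma dcirc_mul_sqnorm f k : dcirc (f * sqnorm ^+ k) = dcirc f * sqnorm ^+ k.
Proof. by rewrite dcircM dcirc_sqnorm mulr0 addr0. Qed.

(** The linear form that vanishes on [line z], with restriction [sin (x - z)]. *)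
Definition linear_factor (z : R) : bpoly R := cos z *: yvar - sin z *: xvar.

Lemma circ_linear_factor z x : circ (linear_factor z) x = sin (x - z).
Proof. by rewrite /linear_factor circB !circZ circ_x circ_y sinB; ring. Qed.

Lemma dcirc_linear_factor z : dcirc (linear_factor z) = cos z *: xvar + sin z *: yvar.
Proof.
by rewrite /linear_factor -scaleNr dcircD !dcircZ dcirc_x dcirc_y scalerN scaleNr opprK.
Qed.

Lemma circ_dcirc_linear_factor z x : circ (dcirc (linear_factor z)) x = cos (x - z).
Proof. by rewrite dcirc_linear_factor circD !circZ circ_x circ_y cosB; ring. Qed.

Lemma circ_dcirc2_linear_factor z x : circ (dcirc (dcirc (linear_factor z))) x = - sin (x - z).
Proof.
rewrite dcirc_linear_factor dcircD !dcircZ dcirc_x dcirc_y circD !circZ circN circ_x circ_y sinB.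
by ring.
Qed.

Lemma form_linear_factor z : binary_form 1 (linear_factor z).
Proof.
by rewrite /linear_factor -scaleNr; apply: formD; apply: formZ; [exact: form_yvar|exact: form_xvar].
Qed.

Lemma linear_factor_eq0 z x : 0 <= z < pi -> 0 <= x < pi -> (circ (linear_factor z) x == 0) = (x == z).
Proof.
move=> zP xP; rewrite circ_linear_factor; apply/eqP/eqP => [/line_eqP|->]; last by rewrite subrr sin0.
exact: line_inj_half_open.
Qed.

Definition hyperbolic r : bpoly R := \prod_(z <- r) linear_factor z.

Lemma form_hyperbolic r : binary_form (size r) (hyperbolic r).
Proof.
rewrite /hyperbolic; elim: r => [|z r IHr]; first by rewrite big_nil; exact: form1.
by rewrite big_cons /= -add1n; apply: formM => //; exact: form_linear_factor.
Qed.

Lemma hyperbolic_eq0 r x : {in r, forall z, 0 <= z < pi} -> 0 <= x < pi ->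
  (circ (hyperbolic r) x == 0) = (x \in r).
Proof.
move=> + xP; elim: r => [|z r IHr] rP; rewrite /hyperbolic.
  by rewrite big_nil circ1 oner_eq0.
rewrite big_cons circM mulf_eq0 in_cons linear_factor_eq0// ?rP ?mem_head// IHr// => y yr.
by apply: rP; rewrite in_cons yr orbT.
Qed.

Lemma hyperbolic_simple r x : uniq r -> {in r, forall z, 0 <= z < pi} -> x \in r ->
  circ (dcirc (hyperbolic r)) x != 0.
Proof.
elim: r => //= z r IHr /andP[zr ur] rP xr.
have rP' : {in r, forall z, 0 <= z < pi}.
  by move=> y yr; apply: rP; rewrite in_cons yr orbT.
rewrite /hyperbolic big_cons dcircM circD !circM -/(hyperbolic r).
have xP := rP _ xr; have zP := rP _ (mem_head z r).
have [xz|xz] := eqVneq x z.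
  rewrite xz circ_dcirc_linear_factor circ_linear_factor subrr sin0 cos0 mul1r mul0r addr0.
  by rewrite hyperbolic_eq0.
have {}xr : x \in r by move: xr; rewrite in_cons (negbTE xz).
have /eqP -> : circ (hyperbolic r) x == 0 by rewrite hyperbolic_eq0.
by rewrite mulr0 add0r mulf_neq0 ?IHr// linear_factor_eq0.
Qed.

(** For a sine, the Laguerre expression is [cos ^+ 2 - sin * (- sin) = 1]. *)
Lemma linear_factor_log_concave z : strictly_log_concave (linear_factor z).
Proof.
have L x : circ (laguerre (linear_factor z)) x = 1.
  rewrite circ_laguerre circ_dcirc2_linear_factor circ_dcirc_linear_factor circ_linear_factor -(cos2Dsin2 (x - z)); ring.
by split=> x; rewrite L.
Qed.

Lemma hyperbolic_log_concave r : log_concave (hyperbolic r).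
Proof.
rewrite /hyperbolic; elim: r => [|z r IHr].
  have e0 x : circ 0 x = 0 :> R by exact: meval0.
  by move=> x; rewrite big_nil circ_laguerre !dcirc1 dcirc0 e0 mulr0 subr0 sqr_ge0.
by rewrite big_cons; exact: log_concaveM (linear_factor_log_concave z).1 IHr.
Qed.

Lemma hyperbolic_strictly_log_concave r : r != [::] -> strictly_log_concave (hyperbolic r).
Proof.
case: r => // z r _; rewrite /hyperbolic big_cons; apply: strictly_log_concaveM.
  exact: linear_factor_log_concave.
exact: hyperbolic_log_concave.
Qed.

End LinearFactors.

(** * A form with prescribed numbers of roots and eigenvectors *)

Section Example.
Context {R : realType} (q K s : nat).
Hypothesis qK0 : (0 < q + K)%N.

Let n := (q + K)%N.
Let z (i : nat) : R := i%:R * pi / n%:R.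

Let n_gt0 : 0 < n%:R :> R.
Proof. by rewrite ltr0n. Qed.

Let z_lt i j : (i < j)%N -> z i < z j.
Proof.
by move=> ij; rewrite /z ltr_pM2r ?invr_gt0// ltr_pM2r ?pi_gt0// ltr_nat.
Qed.

Let z_le i j : (i <= j)%N -> z i <= z j.
Proof. by rewrite leq_eqVlt => /predU1P[->//|/z_lt/ltW]. Qed.

Let z_pi i : (i < n)%N -> 0 <= z i < pi.
Proof.
move=> iN; have pi0 := pi_gt0 R; rewrite /z divr_ge0 ?mulr_ge0 ?(ltW pi0)//=.
by rewrite ltr_pdivrMr// mulrC ltr_pM2l// ltr_nat.
Qed.

Let z_le_pi i : (i <= n)%N -> z i <= pi.
Proof. by move=> iN; rewrite /z ler_pdivrMr// mulrC ler_pM2l ?pi_gt0// ler_nat. Qed.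

Let z_inj : injective z.
Proof. by move=> i j zij; case: (ltngtP i j) => // /z_lt; rewrite zij ltxx. Qed.

Let r1 := [seq z i | i <- iota 0 q].
Let r2 := [seq z i | i <- iota q K].
Let P := hyperbolic r1.
Let Q := hyperbolic r2.

Let mem_r1 i : (z i \in r1) = (i < q)%N.
Proof. by rewrite mem_map// mem_iota. Qed.

Let mem_r2 i : (z i \in r2) = (q <= i < n)%N.
Proof. by rewrite mem_map// mem_iota. Qed.

Let r1_pi : {in r1, forall y, 0 <= y < pi}.
Proof.
move=> _ /mapP[i + ->]; rewrite mem_iota => /andP[_ iq]; apply: z_pi.
by rewrite (leq_trans iq)// leq_addr.
Qed.

Let r2_pi : {in r2, forall y, 0 <= y < pi}.
Proof. by move=> _ /mapP[i + ->]; rewrite mem_iota => /andP[_ iq]; exact: z_pi. Qed.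

(** Each of the [K] double lines adds two critical points, itself and one in a gap,
    but no simple zero. *)
Let base := P * Q ^+ 2.

Let base_concave : strictly_log_concave base.
Proof.
rewrite /base expr2 mulrA; apply: strictly_log_concaveM; last exact: hyperbolic_log_concave.
rewrite /P /Q /hyperbolic -big_cat; apply: hyperbolic_strictly_log_concave.
by rewrite -size_eq0 size_cat !size_map !size_iota -lt0n.
Qed.

Let circ_base x : circ base x = circ P x * circ Q x ^+ 2.
Proof. by rewrite circM circX. Qed.

Let circ_dcirc_base x : circ (dcirc base) x =
  circ (dcirc P) x * circ Q x ^+ 2 + 2 * circ P x * circ Q x * circ (dcirc Q) x.
Proof. by rewrite /base expr2 !dcircM !(circD, circM); ring. Qed.

Let P_form : binary_form q P.
Proof. by have := form_hyperbolic r1; rewrite size_map size_iota. Qed.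

Let Q_form : binary_form K Q.
Proof. by have := form_hyperbolic r2; rewrite size_map size_iota. Qed.

Let base_form : binary_form (q + K * 2) base.
Proof. by apply: formM => //; exact: formX. Qed.

Let base_z i : (i <= n)%N -> circ base (z i) = 0.
Proof.
have base_z_lt j : (j < n)%N -> circ base (z j) = 0.
  move=> jn; rewrite circ_base; have [jq|qj] := ltnP j q.
    have /eqP -> : circ P (z j) == 0 by rewrite hyperbolic_eq0 ?mem_r1// z_pi.
    by rewrite mul0r.
  have /eqP -> : circ Q (z j) == 0 by rewrite hyperbolic_eq0 ?mem_r2 ?qj// z_pi.
  by rewrite expr0n mulr0.
rewrite leq_eqVlt => /predU1P[->|]; last exact: base_z_lt.
have zn : z n = z 0%N + pi by rewrite /z mul0r mul0r add0r mulrC mulKf// gt_eqF.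
by rewrite zn (pi_equivariant_circ base_form) base_z_lt ?mulr0.
Qed.

Let base_neq0 i x : (i < n)%N -> z i < x < z i.+1 -> circ base x != 0.
Proof.
move=> iN xi; have xpi : 0 <= x < pi.
  by have := z_pi iN; have := z_le_pi iN; lra.
have xz j : x != z j.
  apply/eqP => xE; move: xi; rewrite xE => /andP[ij ji].
  have : (i < j)%N.
    by rewrite ltnNge; apply: contraTN ij; rewrite -leNgt; exact: z_le.
  have : (j < i.+1)%N.
    by rewrite ltnNge; apply: contraTN ji; rewrite -leNgt; exact: z_le.
  by rewrite ltnS leqNgt => /negP.
rewrite circ_base mulf_neq0 ?expf_neq0// hyperbolic_eq0//; apply/mapP => -[j _ xE];
  by have := xz j; rewrite xE eqxx.
Qed.

Let c_exists : forall i : 'I_n, exists c, z i < c < z i.+1 /\ circ (dcirc base) c = 0.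
Proof.
move=> i; have [||c cP c0] := @critical_between R _ _ (z i) (z i.+1) (is_derive_circ base).
- exact: z_lt.
- by rewrite !base_z// ltnW.
- by exists c.
Qed.

Let interval_of x : 0 <= x < pi -> exists i : 'I_n, z i <= x < z i.+1.
Proof.
move=> /(cell_exists n.-1)[j] jx.
exists (cast_ord (prednK qK0) j); move: jx; rewrite /cell/= /z.
by move: (nat_of_ord j) => m; rewrite prednK.
Qed.

(** The critical points of [base] are one point [c i] in each gap between
    consecutive zeros, and the [K] double zeros.  At a simple zero the derivative
    does not vanish.  All are nondegenerate: in the gaps by strict
    log-concavity, at a double zero because the second derivative is
    [2 * P * (dcirc Q) ^+ 2] there. *)
Lemma exists_critical_family : exists w : 'I_n + 'I_K -> R,
  [/\ injective w, (forall i, 0 <= w i < pi),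
      (forall i, circ (dcirc base) (w i) = 0),
      (forall i, circ (dcirc (dcirc base)) (w i) != 0) &
      (forall x, 0 <= x < pi -> circ (dcirc base) x = 0 -> exists i, x = w i)].
Proof.
have /choice[c cP] := c_exists.
have zK (k : 'I_K) : (q + k < n)%N by rewrite ltn_add2l.
have c_neq_z i (k : 'I_K) : c i != z (q + k).
  apply: contraTneq (base_neq0 (ltn_ord i) (cP i).1) => ->.
  by rewrite base_z ?eqxx// ltnW.
have c_lt (i j : 'I_n) : (i < j)%N -> c i < c j.
  move=> ij; have [/andP[_ ci] _] := cP i; have [/andP[jc _] _] := cP j.
  apply: lt_le_trans ci (le_trans _ (ltW jc)).
  exact: z_le.
exists (fun u : 'I_n + 'I_K => match u with inl i => c i | inr k => z (q + k)%N end); split.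
- move=> [i|i] [j|j] /= E.
  + congr inl; apply/val_inj.
    by case: (ltngtP i j) => // /c_lt; rewrite E ltxx.
  + by have := c_neq_z i j; rewrite E eqxx.
  + by have := c_neq_z j i; rewrite E eqxx.
  + by congr inr; apply/val_inj/(@addnI q)/z_inj.
- move=> [i|k]; last exact: z_pi.
  have [/andP[zc cz] _] := cP i; have := z_pi (ltn_ord i).
  have : z i.+1 <= pi by exact: z_le_pi.
  by lra.
- move=> [i|k]; first by have [] := cP i.
  have /eqP Q0 : circ Q (z (q + k)) == 0 by rewrite hyperbolic_eq0 ?z_pi// mem_r2 leq_addr zK.
  by rewrite circ_dcirc_base Q0 expr0n !mulr0 mul0r addr0.
- move=> [i|k].
    apply: critical_nondegenerate base_concave _ (cP i).2.
    exact: base_neq0 (ltn_ord i) (cP i).1.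
  have /eqP Q0 : circ Q (z (q + k)) == 0 by rewrite hyperbolic_eq0 ?z_pi// mem_r2 leq_addr zK.
  have P0 : circ P (z (q + k)) != 0.
    by rewrite hyperbolic_eq0 ?z_pi// mem_r1 -leqNgt leq_addr.
  have Q1 : circ (dcirc Q) (z (q + k)) != 0.
    by apply: hyperbolic_simple => //; rewrite ?map_inj_uniq ?iota_uniq// mem_r2 leq_addr zK.
  have -> : circ (dcirc (dcirc base)) (z (q + k)) =
      2 * circ P (z (q + k)) * circ (dcirc Q) (z (q + k)) ^+ 2.
    rewrite /base expr2 !(dcircM, dcircD) !(circD, circM) Q0; ring.
  by rewrite !mulf_neq0 ?expf_neq0 ?pnatr_eq0.
- move=> x xP x0; have [i /andP[]] := interval_of xP.
  rewrite le_eqVlt => /predU1P[xz _|zx xz]; last first.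
    exists (inl i); apply: (critical_uniq base_concave (u := z i) (v := z i.+1)) => //.
    + by move=> y; exact: base_neq0.
    + by rewrite zx.
    + by case: (cP i).
    + by case: (cP i).
  have [iq|qi] := ltnP i q.
    exfalso; move: x0; rewrite circ_dcirc_base -xz.
    have /eqP -> : circ P (z i) == 0 by rewrite hyperbolic_eq0 ?mem_r1// z_pi.
    move=> /eqP; rewrite mulr0 mul0r mul0r addr0 mulf_eq0 expf_eq0/=.
    rewrite (negbTE (hyperbolic_simple _ _ _)) ?mem_r1 ?map_inj_uniq ?iota_uniq//.
    by rewrite hyperbolic_eq0 ?z_pi// mem_r2 leqNgt iq.
  have iK : (i - q < K)%N by rewrite ltn_subLR.
  by exists (inr (Ordinal iK)); rewrite /= subnKC.
Qed.

Let d := (q + K * 2 + 2 * s)%N.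

Let f0 := base * sqnorm ^+ s.

(** The direction of perturbation: adding [eps *: p] to [f0] replaces [Q ^+ 2] by
    [Q ^+ 2 + eps] on the circle, which removes the double zeros and keeps the simple
    ones. *)
Let p := P * sqnorm ^+ (K + s).

Let f0_form : binary_form d f0.
Proof. by apply: formM => //; exact: form_sqnorm. Qed.

Let p_form : binary_form d p.
Proof.
have -> : d = (q + 2 * (K + s))%N by rewrite /d mulnDr addnA [(2 * K)%N]mulnC.
by apply: formM => //; exact: form_sqnorm.
Qed.

Lemma stable_critical : exists2 e, 0 < e &
  forall b : d.+1.-tuple R, (forall i, `|tnth b i - tnth (form_coords d f0) i| < e) ->
    counting (real_eigenvectors (form_of b)) = (n + K)%:R%:E :> \bar R.
Proof.
have [w [wI wpi w0 w1 wall]] := exists_critical_family.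
have dfE a : dcirc (form_of a) = span_form (@dcirc R \o @monomial R d) a.
  exact: dcirc_span_form.
have [||||e e0 eP] := @stable_real_roots R _ d (@dcirc R \o @monomial R d)
  _ _ w (form_coords d f0) wI wpi.
- by move=> i; apply: dcirc_form; exact: form_monomial.
- by move=> i; rewrite -dfE form_ofK// dcirc_mul_sqnorm circ_mul_sqnorm.
- by move=> i; rewrite -dfE form_ofK// !dcirc_mul_sqnorm circ_mul_sqnorm.
- by move=> x; rewrite -dfE form_ofK// dcirc_mul_sqnorm circ_mul_sqnorm; exact: wall.
exists e => // b /eP; rewrite eigenvectors_dcirc dfE => ->.
by rewrite card_sum !card_ord.
Qed.

Lemma stable_roots eps : 0 < eps -> exists2 e, 0 < e &
  forall b : d.+1.-tuple R,
    (forall i, `|tnth b i - tnth (form_coords d (f0 + eps *: p)) i| < e) ->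
    counting (real_roots (form_of b)) = q%:R%:E :> \bar R.
Proof.
move=> eps0; set f := f0 + eps *: p.
have fE : form_of (form_coords d f) = f by rewrite form_ofK//; apply: formD => //; exact: formZ.
have evf x : circ f x = circ P x * (circ Q x ^+ 2 + eps).
  by rewrite circD circZ !circ_mul_sqnorm circ_base; ring.
have Qeps x : circ Q x ^+ 2 + eps != 0.
  by rewrite gt_eqF// ltr_wpDl// sqr_ge0.
have zq (i : 'I_q) : (i < n)%N by rewrite (leq_trans (ltn_ord i))// leq_addr.
have P0 (i : 'I_q) : circ P (z i) = 0 by apply/eqP; rewrite hyperbolic_eq0 ?mem_r1// z_pi.
have [|||||e e0 eP] := @stable_real_roots R _ d (@monomial R d) (@form_monomial R d) _
   (fun i : 'I_q => z i) (form_coords d f).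
- by move=> i j /z_inj/val_inj.
- by move=> i; exact: z_pi.
- by move=> i; rewrite [span_form _ _]fE evf P0 mul0r.
- move=> i; rewrite [span_form _ _]fE dcircD dcircZ !dcirc_mul_sqnorm circD circZ !circ_mul_sqnorm.
  rewrite circ_dcirc_base P0 mulr0 !mul0r addr0 [eps * _]mulrC -mulrDr mulf_neq0//.
  by apply: hyperbolic_simple; rewrite ?mem_r1// map_inj_uniq// iota_uniq.
- move=> x xpi; rewrite [span_form _ _]fE evf => /eqP.
  rewrite mulf_eq0 (negbTE (Qeps x)) orbF hyperbolic_eq0// => /mapP[i].
  by rewrite mem_iota => /andP[_ iq] ->; exists (Ordinal iq).
by exists e => // b /eP; rewrite card_ord.
Qed.

(** [eps] is chosen so that [f0 + eps *: p] remains within half of the stability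
    radius [e1] of the critical points of [f0]; the other half is left for the
    box around it. *)
Lemma exists_open_box : exists (a : d.+1.-tuple R) (e : R), 0 < e /\
  forall b : d.+1.-tuple R, (forall i, `|tnth b i - tnth a i| < e) ->
    counting (real_roots (form_of b)) = q%:R%:E :> \bar R /\
    counting (real_eigenvectors (form_of b)) = (n + K)%:R%:E :> \bar R.
Proof.
have [e1 e10 e1P] := stable_critical.
pose S := 1 + \sum_i `|tnth (form_coords d p) i|.
have S0 : 0 < S by rewrite ltr_pwDl// sumr_ge0.
pose eps := e1 / 2 / S.
have eps0 : 0 < eps by rewrite !divr_gt0.
have [e2 e20 e2P] := stable_roots eps0.
exists (form_coords d (f0 + eps *: p)), (Num.min e2 (e1 / 2)).
split=> [|b ba]; first by rewrite lt_min e20 divr_gt0.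
split; first by apply: e2P => i; have := ba i; rewrite lt_min => /andP[].
apply: e1P => i; have := ba i; rewrite lt_min => /andP[_].
have -> : tnth (form_coords d (f0 + eps *: p)) i =
    tnth (form_coords d f0) i + eps * tnth (form_coords d p) i.
  by rewrite !tnth_mktuple mcoeffD mcoeffZ.
have : `|eps * tnth (form_coords d p) i| < e1 / 2.
  rewrite normrM (gtr0_norm eps0) /eps mulrAC ltr_pdivrMr// ltr_pM2l ?divr_gt0//.
  rewrite /S (bigD1 i)//= addrCA ltrDl ltr_pwDl// sumr_ge0//.
rewrite !ltr_norml; move: (eps * _) => u.
by lra.
Qed.

End Example.

Theorem theorem3p2 (R : realType) (d : nat) (hd : (1 <= d)%N) :
  (forall f : bpoly R, binary_form d f -> f != 0 ->
     (Order.max (counting (real_roots f) : \bar R) 1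
        <= counting (real_eigenvectors f))%E) /\
  (forall q t : nat,
     q = d %[mod 2] -> t = d %[mod 2] ->
     (maxn q 1 <= t)%N -> (t <= d)%N ->
     positive_volume d
       [set f : bpoly R | [/\ binary_form d f,
          counting (real_roots f) = q%:R%:E :> \bar R &
          counting (real_eigenvectors f) = t%:R%:E :> \bar R]]).
Proof.
split=> [f fd _|q t qd td qt tdd].
  have dfd := dcirc_form fd.
  rewrite eigenvectors_dcirc !(real_roots_zero_lines fd, real_roots_zero_lines dfd).
  rewrite ge_max; apply/andP; split.
    apply: counting_le => n w; exact: critical_lines_injection (is_derive_circ f)
      (pi_equivariant_circ fd) (pi_equivariant_circ dfd).
  have [l l0] := critical_line_exists (is_derive_circ f)
    (pi_equivariant_circ fd) (pi_equivariant_circ dfd).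
  apply/(counting_geP _ 1); exists (fun=> l); split=> // i j _.
  by rewrite !ord1.
rewrite /positive_volume.
have -> : [set f : bpoly R | [/\ binary_form d f,
     counting (real_roots f) = q%:R%:E :> \bar R &
     counting (real_eigenvectors f) = t%:R%:E :> \bar R]] =
   [set f | binary_form d f /\ (counting (real_roots f) = q%:R%:E :> \bar R /\
     counting (real_eigenvectors f) = t%:R%:E :> \bar R)].
  by apply/seteqP; split=> f /=; [case|case=> ? []].
rewrite image_form_coords; split.
  under eq_set => a do rewrite eigenvectors_dcirc [dcirc _]dcirc_span_form.
  apply: measurableI; apply: (@measurable_real_roots_eq R _ d) => i; last apply: dcirc_form;
    exact: form_monomial.
have [q1 t1] : (q <= t)%N /\ (0 < t)%N by move: qt; rewrite geq_max => /andP[].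
pose K := (t - q)./2; pose s := (d - t)./2.
have half_gap m k : (m <= k)%N -> m = k %[mod 2] -> k = (m + (k - m)./2 * 2)%N.
  move=> mk; rewrite !modn2 => /(congr1 odd); rewrite !oddb => mk2.
  by rewrite muln2 even_halfK ?subnKC// oddB// mk2 addbb.
have tE : t = (q + K * 2)%N by apply: half_gap => //; rewrite qd td.
have dE : d = (q + K * 2 + 2 * s)%N by rewrite -tE mulnC; exact: half_gap.
have qK : (0 < q + K)%N by move: t1; rewrite tE; case: (q) (K) => [|?] [|?].
have [a [e [e0 aP]]] := @exists_open_box R q K s qK.
move: a e e0 aP; rewrite -dE => a e e0 aP.
have [c c0 cP] := lebesgue_tuple_box a e0.
apply: lt_le_trans (cP _ _); first by rewrite lte_fin.
move=> b /aP[b1 b2]; split=> //; rewrite b2; congr (_%:R%:E).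
by rewrite tE muln2 -addnn addnA.
Qed.
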